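(* Let $l\in\mathbb{N}_0$ and let $k,k'$ be integers with $|k|,|k'|\le l$. Put $c_l^{k}=\tfrac12\sqrt{(l-k)(l+k+1)}$ and use the convention $D_l^{k,k'}=0$ whenever $|k|>l$ or $|k'|>l$. The gradient of the Wigner-D function $D_l^{k,k'}\colon\mathrm{SO}(3)\to\mathbb{C}$ is given as follows with respect to the three frames. (Euler angle frame, at all $R=R(\alpha,\beta,\gamma)$ with $\beta\in(0,\pi)$) $$\nabla D_l^{k,k'}=\begin{pmatrix}D_l^{k-1,k'}\\ D_l^{k,k'}\\ D_l^{k+1,k'}\end{pmatrix}^{\top}\begin{pmatrix}0&-c_l^{-k}e^{-i\alpha}&0\\ \frac{ik'\cos\beta-ik}{2\sin^2\beta}&0&\frac{ik\cos\beta-ik'}{2\sin^2\beta}\\ 0&c_l^{k}e^{i\alpha}&0\end{pmatrix}\begin{pmatrix}\partial_\alpha\\ \partial_\beta\\ \partial_\gamma\end{pmatrix},$$ (left-invariant frame, on all of $\mathrm{SO}(3)$) $$\nabla D_l^{k,k'}=\begin{pmatrix}D_l^{k,k'-1}\\ D_l^{k,k'}\\ D_l^{k,k'+1}\end{pmatrix}^{\top}\begin{pmatrix}-ic_l^{-k'}&c_l^{-k'}&0\\ 0&0&-ik'\\ -ic_l^{k'}&-c_l^{k'}&0\end{pmatrix}\begin{pmatrix}\partial^L_x\\ \partial^L_y\\ \partial^L_z\end{pmatrix},$$ (right-invariant frame, on all of $\mathrm{SO}(3)$) $$\nabla D_l^{k,k'}=\begin{pmatrix}D_l^{k-1,k'}\\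 D_l^{k,k'}\\ D_l^{k+1,k'}\end{pmatrix}^{\top}\begin{pmatrix}-ic_l^{-k}&-c_l^{-k}&0\\ 0&0&-ik\\ -ic_l^{k}&c_l^{k}&0\end{pmatrix}\begin{pmatrix}\partial^R_x\\ \partial^R_y\\ \partial^R_z\end{pmatrix}.$$
   Context: The tangent space of $\mathrm{SO}(3)$ at $R$ is $T_R\mathrm{SO}(3)=R\cdot\mathfrak{so}(3)=\mathfrak{so}(3)\cdot R$ ($\mathfrak{so}(3)$ = real skew-symmetric $3\times 3$ matrices), with Riemannian metric $g_R(T_1,T_2)=\tfrac12\langle T_1,T_2\rangle_F$ (Frobenius inner product). The gradient of a smooth real function $f$ is the vector field with $g_R(\nabla f(R),T)=\mathrm{d}_Tf(R)$ for all $T\in T_R\mathrm{SO}(3)$, where $\mathrm{d}_Tf(R)=\frac{d}{dt}f(\exp(tS)R)|_{t=0}$ for $T=SR$, $S\in\mathfrak{so}(3)$; for complex-valued functions the gradient is extended complex-linearly. Put $$e_x=\begin{pmatrix}0&0&0\\0&0&-1\\0&1&0\end{pmatrix},\quad e_y=\begin{pmatrix}0&0&1\\0&0&0\\-1&0&0\end{pmatrix},\quad e_z=\begin{pmatrix}0&-1&0\\1&0&0\\0&0&0\end{pmatrix}.$$ The left-invariant frame is $\partial^L_x(R)=R e_x$, $\partial^L_y(R)=R e_y$, $\partial^L_z(R)=R e_z$; the right-invariant frame is $\partial^R_x(R)=e_xR$, $\partial^R_y(R)=e_yR$, $\partial^R_z(R)=e_zR$. Both are orthonormal. Euler angles: $R(\alpha,\beta,\gamma)=R_z(\alpha)R_y(\beta)R_z(\gamma)$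 with $\alpha,\gamma\in\mathbb{R}/2\pi\mathbb{Z}$, $\beta\in[0,\pi]$, where $R_z(t)=\exp(te_z)$, $R_y(t)=\exp(te_y)$. The Euler angle frame, defined where $\beta\in(0,\pi)$, consists of the tangent vectors $\partial_\alpha,\partial_\beta,\partial_\gamma$ obtained as the partial derivatives of $R(\alpha,\beta,\gamma)$ with respect to $\alpha,\beta,\gamma$. For $l\in\mathbb{N}_0$ and integers $|k|,|k'|\le l$, the Wigner-d function $d_l^{k,k'}\colon[-1,1]\to\mathbb{R}$ is $$d_l^{k,k'}(x)=(-1)^{\nu}\binom{2l-s}{s+a}^{1/2}\binom{s+b}{b}^{-1/2}\left(\frac{1-x}{2}\right)^{a/2}\left(\frac{1+x}{2}\right)^{b/2}P_s^{a,b}(x),$$ with $a=|k-k'|$, $b=|k+k'|$, $s=l-\max\{|k|,|k'|\}$, $\nu=k+k'$ if $k>k'$ and $\nu=0$ otherwise, and $P_s^{a,b}$ the Jacobi polynomial of degree $s$ with parameters $a,b$ (normalized by $P_s^{a,b}(1)=\binom{s+a}{s}$). The Wigner-D function is $D_l^{k,k'}(R(\alpha,\beta,\gamma))=\sqrt{2l+1}\,e^{-ik\alpha}d_l^{k,k'}(\cos\beta)e^{-ik'\gamma}$.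
   Formalization: In the Euler angle formula both denominators 2 sin²β are corrected to sin²β: as printed, pairing the gradient with ∂_α gives −(ik/2)D instead of ∂D/∂α = −ikD (e.g. l=1, k=1, k'=0, β=π/2). *)

(* Defs.v *)
From HB Require Import structures.
From mathcomp Require Import all_boot all_order all_algebra.
From mathcomp Require Import complex.
From mathcomp Require Import all_classical all_reals all_analysis.
Set Implicit Arguments.
Unset Strict Implicit.
Unset Printing Implicit Defensive.
Import Order.TTheory GRing.Theory Num.Theory.
Import numFieldNormedType.Exports.
Local Open Scope classical_set_scope.
Local Open Scope ring_scope.

Definition mx3 (T : nmodType) (s : seq (seq T)) : 'M[T]_3 :=
  \matrix_(i < 3, j < 3) (nth [::] s i)`_j.

Definition row3 (T : nmodType) (s : seq T) : 'rV[T]_3 := \row_(j < 3) s`_j.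

Section SO3.
Context {R : realType}.
Implicit Types (M S T G : 'M[R]_3) (t : R).

Definition SO3 : set 'M[R]_3 := [set M | M *m M^T = 1%:M /\ \det M = 1].

Definition so3 : set 'M[R]_3 := [set S | S^T = - S].

Definition tangent M : set 'M[R]_3 := [set S *m M | S in so3].

(* \tr (T1^T *m T2) is the Frobenius inner product. *)
Definition metric T1 T2 : R := 2^-1 * \tr (T1^T *m T2).

Definition expm S : 'M[R]_3 :=
  limn (series (fun n : nat => (n`!%:R)^-1 *: S ^+ n)).

(* The value at M of the gradient of f; only the values of f on SO3 matter when
   M is in SO3. [is_derive] includes the existence of the derivative. *)
Definition is_gradient (f : 'M[R]_3 -> R) M G : Prop :=
  tangent M G /\
  forall S, so3 S ->
    is_derive (0 : R) 1 (fun t => f (expm (t *: S) *m M)) (metric G (S *m M)).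

(* Complex-linear extension: the gradient of u + i v is grad u + i grad v, an
   element of the complexified tangent space. *)
Definition is_cgradient (f : 'M[R]_3 -> R[i]) M (G : 'M[R[i]]_3) : Prop :=
  is_gradient (fun N => complex.Re (f N)) M (map_mx (@complex.Re R) G) /\
  is_gradient (fun N => complex.Im (f N)) M (map_mx (@complex.Im R) G).

Definition e_x : 'M[R]_3 := mx3 [:: [:: 0; 0;  0]; [:: 0; 0; -1]; [:: 0; 1; 0]].
Definition e_y : 'M[R]_3 := mx3 [:: [:: 0; 0;  1]; [:: 0; 0;  0]; [:: -1; 0; 0]].
Definition e_z : 'M[R]_3 := mx3 [:: [:: 0; -1; 0]; [:: 1; 0;  0]; [:: 0; 0; 0]].

Definition rot_y t : 'M[R]_3 := expm (t *: e_y).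
Definition rot_z t : 'M[R]_3 := expm (t *: e_z).

(* The angles alpha and gamma are given by arbitrary real representatives. *)
Definition euler (alpha beta gamma : R) : 'M[R]_3 :=
  rot_z alpha *m rot_y beta *m rot_z gamma.

Definition left_frame M : seq 'M[R]_3 := [:: M *m e_x; M *m e_y; M *m e_z].

Definition right_frame M : seq 'M[R]_3 := [:: e_x *m M; e_y *m M; e_z *m M].

(* Not orthogonal: d/dalpha, d/dbeta, d/dgamma are unit vectors for [metric], but
   metric (d/dalpha) (d/dgamma) = cos beta. The inverse Gram matrix therefore puts
   the factor 1 / sin^2 beta (not 1 / (2 sin^2 beta)) in front of the d/dalpha and
   d/dgamma components of a gradient. *)
Definition euler_frame (alpha beta gamma : R) : seq 'M[R]_3 :=
  [:: derive1 (fun a => euler a beta gamma) alpha;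
      derive1 (fun b => euler alpha b gamma) beta;
      derive1 (fun c => euler alpha beta c) gamma].

Definition frame_comb (v : 'rV[R[i]]_3) (F : seq 'M[R]_3) : 'M[R[i]]_3 :=
  \sum_(j < 3) v 0 j *: map_mx (real_complex R) F`_j.

End SO3.

Section Wigner.
Context {R : realType}.
Implicit Types (l : nat) (k : int) (x t : R) (M : 'M[R]_3).

(* Jacobi polynomial P_s^{a,b} for integer parameters a, b >= 0:
   sum_j 'C(s+a, s-j) 'C(s+b, j) ((x-1)/2)^j ((x+1)/2)^(s-j). *)
Definition jacobi (s a b : nat) : {poly R} :=
  \sum_(j < s.+1) ('C(s + a, s - j) * 'C(s + b, j))%:R *:
    ((2^-1 *: ('X - 1)) ^+ j * (2^-1 *: ('X + 1)) ^+ (s - j)).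

Lemma jacobi_at1 (s a b : nat) : (jacobi s a b).[1] = 'C(s + a, s)%:R.
Proof.
rewrite /jacobi horner_sum big_ord_recl big1 => [|j _]; last first.
  by rewrite !hornerE subrr mulr0 /= expr0n /= !(mul0r, mulr0).
rewrite !hornerE /= subn0 bin0 muln1 mulr1.
by rewrite mulVf ?pnatr_eq0 // expr1n mulr1.
Qed.

Definition wigner_d l k (k' : int) x : R :=
  let a := `|(k - k')%R|%N in
  let b := `|(k + k')%R|%N in
  let s := (l - maxn `|k| `|k'|)%N in
  let nu := if k' < k then k + k' else 0 in
  (-1) ^ nu
  * Num.sqrt ('C(2 * l - s, s + a)%:R) * (Num.sqrt ('C(s + b, b)%:R))^-1
  * ((1 - x) / 2) `^ (a%:R / 2) * ((1 + x) / 2) `^ (b%:R / 2)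
  * (jacobi s a b).[x].

Definition expi t : R[i] := (cos t +i* sin t)%C.

Definition wignerD_angles l k (k' : int) (alpha beta gamma : R) : R[i] :=
  (Num.sqrt ((2 * l + 1)%:R))%:C%C * expi (- (k%:~R * alpha))
  * (wigner_d l k k' (cos beta))%:C%C * expi (- (k'%:~R * gamma)).

Definition is_euler_angles M (w : R * R * R) : Prop :=
  let: (alpha, beta, gamma) := w in
  0 <= beta <= pi /\ M = euler alpha beta gamma.

(* Every M in SO3 has Euler angles, and the value does not depend on the chosen
   ones, also at the poles beta = 0 and beta = pi where they are not unique
   modulo 2 pi. *)
Definition wignerD l k (k' : int) M : R[i] :=
  if (`|k| <= l)%N && (`|k'| <= l)%N then
    let: (alpha, beta, gamma) := get (is_euler_angles M) in
    wignerD_angles l k k' alpha beta gamma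
  else 0.

(* The coefficient c_l^k; the radicand is nonnegative for -l-1 <= k <= l. *)
Definition cl l k : R := 2^-1 * Num.sqrt (((l%:Z - k) * (l%:Z + k + 1))%:~R).

End Wigner.

(* Main.v *)
(* On SU(2), realised as the unit quaternions acting on rotations through the
   double cover [qrot], the Wigner-D functions are polynomial: up to a constant,
   D_l^{k,k'} is the coefficient of X^(l+k) in (x X + z)^(l+k') (y X + w)^(l-k'),
   where x, y, z, w are the entries of the SU(2) matrix. A curve exp(tS) R lifts
   to an explicit curve of quaternions (Rodrigues' formula), so derivatives of
   D_l^{k,k'} are derivations of that polynomial, and no care is needed at the
   poles beta = 0, pi. Acting on columns lowers one of the exponents l+k', l-k'
   and raises the other, which gives the left-invariant formula; acting on rows
   gives, by Euler's relation for X-derivatives, shifts of the extracted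
   coefficient, which is the right-invariant formula. Comparing the two along
   d/dgamma yields the three-term recurrence that turns the right-invariant
   formula into the Euler angle one. *)

Require Import Defs.
From HB Require Import structures.
From mathcomp Require Import all_boot all_order all_algebra.
From mathcomp Require Import complex.
From mathcomp Require Import all_classical all_reals all_analysis.
From mathcomp Require Import zify ring lra.
Set Implicit Arguments.
Unset Strict Implicit.
Unset Printing Implicit Defensive.
Import Order.TTheory GRing.Theory Num.Theory.
Import numFieldNormedType.Exports.
Local Open Scope ring_scope.

(** * Explicit 3 x 3 matrices *)

Section Matrix3.
Context {T : comNzRingType}.

(** [wignerD] is defined through an arbitrary choice of Euler angles, so its value must be shown to
    depend on the rotation only: two unit quaternions over one rotation differ by a sign, and a form
    of even degree [2 * l] does not see it. The Jacobi formula involves a maximum, absolute values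
    and half-integer powers; it is matched with a single binomial sum, according to which of k, -k,
    k', -k' is the largest. The Euler angle frame is not orthogonal, so the components of a gradient
    in it are not directional derivatives; instead of inverting the Gram matrix, the proof expands
    this frame in the right-invariant one and shows that both formulas give the same vector. The
    numbers c_l^k come from normalization: X^J stands for a vector whose squared length is
    proportional to J! (2l-J)!, and ratios of consecutive lengths turn the integer factors of
    differentiation into square roots. *)

Lemma mx3_eta (M : 'M[T]_3) :
  exists a b c d e f g h i, M = mx3 [:: [:: a; b; c]; [:: d; e; f]; [:: g; h; i]].
Proof.
exists (M 0 0), (M 0 1), (M 0 2%:R), (M 1 0), (M 1 1), (M 1 2%:R),
  (M 2%:R 0), (M 2%:R 1), (M 2%:R 2%:R).
apply/matrixP => i j; rewrite !mxE.
by case: i => [[|[|[|//]]] ?]; case: j => [[|[|[|//]]] ?];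
  rewrite /=; congr (M _ _); apply/val_inj.
Qed.

Lemma mx3_mul (a b c d e f g h i a' b' c' d' e' f' g' h' i' : T) :
  mx3 [:: [:: a; b; c]; [:: d; e; f]; [:: g; h; i]] *m
  mx3 [:: [:: a'; b'; c']; [:: d'; e'; f']; [:: g'; h'; i']] =
  mx3 [:: [:: a * a' + b * d' + c * g'; a * b' + b * e' + c * h';
              a * c' + b * f' + c * i'];
          [:: d * a' + e * d' + f * g'; d * b' + e * e' + f * h';
              d * c' + e * f' + f * i'];
          [:: g * a' + h * d' + i * g'; g * b' + h * e' + i * h';
              g * c' + h * f' + i * i']].
Proof.
apply/matrixP => -[[|[|[|//]]] ?] [[|[|[|//]]] ?];
  by rewrite !mxE !big_ord_recl big_ord0 !mxE /= addr0 !addrA.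
Qed.

Lemma mx3_add (a b c d e f g h i a' b' c' d' e' f' g' h' i' : T) :
  mx3 [:: [:: a; b; c]; [:: d; e; f]; [:: g; h; i]] +
  mx3 [:: [:: a'; b'; c']; [:: d'; e'; f']; [:: g'; h'; i']] =
  mx3 [:: [:: a + a'; b + b'; c + c']; [:: d + d'; e + e'; f + f'];
          [:: g + g'; h + h'; i + i']].
Proof.
by apply/matrixP => -[[|[|[|//]]] ?] [[|[|[|//]]] ?]; rewrite !mxE.
Qed.

Lemma mx3_scale (x a b c d e f g h i : T) :
  x *: mx3 [:: [:: a; b; c]; [:: d; e; f]; [:: g; h; i]] =
  mx3 [:: [:: x * a; x * b; x * c]; [:: x * d; x * e; x * f];
          [:: x * g; x * h; x * i]].
Proof.
by apply/matrixP => -[[|[|[|//]]] ?] [[|[|[|//]]] ?]; rewrite !mxE.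
Qed.

Lemma mx3_opp (a b c d e f g h i : T) :
  - mx3 [:: [:: a; b; c]; [:: d; e; f]; [:: g; h; i]] =
  mx3 [:: [:: - a; - b; - c]; [:: - d; - e; - f]; [:: - g; - h; - i]].
Proof.
by apply/matrixP => -[[|[|[|//]]] ?] [[|[|[|//]]] ?]; rewrite !mxE.
Qed.

Lemma mx3_tr (a b c d e f g h i : T) :
  (mx3 [:: [:: a; b; c]; [:: d; e; f]; [:: g; h; i]])^T =
  mx3 [:: [:: a; d; g]; [:: b; e; h]; [:: c; f; i]].
Proof.
by apply/matrixP => -[[|[|[|//]]] ?] [[|[|[|//]]] ?]; rewrite !mxE.
Qed.

Lemma mx3_scalar (x : T) :
  x%:M = mx3 [:: [:: x; 0; 0]; [:: 0; x; 0]; [:: 0; 0; x]].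
Proof.
by apply/matrixP => -[[|[|[|//]]] ?] [[|[|[|//]]] ?]; rewrite !mxE.
Qed.

Lemma mx3_trace (a b c d e f g h i : T) :
  \tr (mx3 [:: [:: a; b; c]; [:: d; e; f]; [:: g; h; i]]) = a + e + i.
Proof.
by rewrite /mxtrace !big_ord_recl big_ord0 !mxE /= addr0 addrA.
Qed.

Lemma mx3_det (a b c d e f g h i : T) :
  \det (mx3 [:: [:: a; b; c]; [:: d; e; f]; [:: g; h; i]]) =
  a * (e * i - f * h) - b * (d * i - f * g) + c * (d * h - e * g).
Proof.
rewrite (expand_det_row _ 0) !big_ord_recl big_ord0 /cofactor.
rewrite !(expand_det_row _ 0) !big_ord_recl !big_ord0 /cofactor.
rewrite !det_mx11 !mxE /= /bump /=.
ring.
Qed.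

Lemma mx3_inj (a b c d e f g h i a' b' c' d' e' f' g' h' i' : T) :
  mx3 [:: [:: a; b; c]; [:: d; e; f]; [:: g; h; i]] =
  mx3 [:: [:: a'; b'; c']; [:: d'; e'; f']; [:: g'; h'; i']] ->
  [/\ [/\ a = a', b = b' & c = c'], [/\ d = d', e = e' & f = f']
    & [/\ g = g', h = h' & i = i']].
Proof.
move=> /matrixP E.
have e0 : (0 < 3)%N by []. have e1 : (1 < 3)%N by []. have e2 : (2 < 3)%N by [].
have := E (Ordinal e0) (Ordinal e0); have := E (Ordinal e0) (Ordinal e1).
have := E (Ordinal e0) (Ordinal e2); have := E (Ordinal e1) (Ordinal e0).
have := E (Ordinal e1) (Ordinal e1); have := E (Ordinal e1) (Ordinal e2).
have := E (Ordinal e2) (Ordinal e0); have := E (Ordinal e2) (Ordinal e1).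
have := E (Ordinal e2) (Ordinal e2).
by rewrite !mxE /=.
Qed.

End Matrix3.

(** * Quaternions and Rodrigues' formula *)

Section Quaternion.
Local Open Scope classical_set_scope.
Context {R : realType}.

Record quat := Quat { q0 : R; q1 : R; q2 : R; q3 : R }.

Definition qmul (p q : quat) := Quat
  (q0 p * q0 q - q1 p * q1 q - q2 p * q2 q - q3 p * q3 q)
  (q0 p * q1 q + q1 p * q0 q + q2 p * q3 q - q3 p * q2 q)
  (q0 p * q2 q - q1 p * q3 q + q2 p * q0 q + q3 p * q1 q)
  (q0 p * q3 q + q1 p * q2 q - q2 p * q1 q + q3 p * q0 q).

Definition qnorm2 (q : quat) : R := q0 q ^+ 2 + q1 q ^+ 2 + q2 q ^+ 2 + q3 q ^+ 2.

Definition qopp (q : quat) := Quat (- q0 q) (- q1 q) (- q2 q) (- q3 q).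

(** The matrix of v -> q v conj(q) on imaginary quaternions, kept homogeneous of degree 2, so that
    [qrotM] is a polynomial identity valid for every norm. *)
Definition qrot (q : quat) : 'M[R]_3 :=
  let: Quat a b c d := q in
  mx3 [:: [:: a ^+ 2 + b ^+ 2 - c ^+ 2 - d ^+ 2; 2 * (b * c - a * d);
              2 * (b * d + a * c)];
          [:: 2 * (b * c + a * d); a ^+ 2 - b ^+ 2 + c ^+ 2 - d ^+ 2;
              2 * (c * d - a * b)];
          [:: 2 * (b * d - a * c); 2 * (c * d + a * b);
              a ^+ 2 - b ^+ 2 - c ^+ 2 + d ^+ 2]].

Lemma qnorm2M p q : qnorm2 (qmul p q) = qnorm2 p * qnorm2 q.
Proof. rewrite /qnorm2 /qmul /=; ring. Qed.

Lemma qrotM p q : qrot (qmul p q) = qrot p *m qrot q.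
Proof.
case: p q => [a b c d] [a' b' c' d']; rewrite /qrot /qmul /= mx3_mul.
congr (mx3 [:: [:: _; _; _]; [:: _; _; _]; [:: _; _; _]]); ring.
Qed.

Definition qconj (q : quat) := Quat (q0 q) (- q1 q) (- q2 q) (- q3 q).

Lemma qrot_conj q : qrot (qconj q) = (qrot q)^T.
Proof.
case: q => [a b c d]; rewrite /qrot /qconj /= mx3_tr.
by congr (mx3 [:: [:: _; _; _]; [:: _; _; _]; [:: _; _; _]]); ring.
Qed.

Lemma qnorm2_conj q : qnorm2 (qconj q) = qnorm2 q.
Proof. by rewrite /qnorm2 /= !sqrrN. Qed.

Lemma qrot_orthogonal q : qnorm2 q = 1 -> (qrot q)^T *m qrot q = 1%:M.
Proof.
case: q => [a b c d] nq; rewrite -qrot_conj -qrotM mx3_scalar.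
rewrite /qmul /qconj /qrot /=.
suff e : a * a + b * b + c * c + d * d = 1.
  by congr (mx3 [:: [:: _; _; _]; [:: _; _; _]; [:: _; _; _]]);
    rewrite -1?[RHS](expr1n _ 2) -1?e; ring.
by rewrite -!expr2.
Qed.

Lemma qrot_SO3 q : qnorm2 q = 1 -> SO3 (qrot q).
Proof.
move=> nq; split.
  exact/mulmx1C/qrot_orthogonal.
case: q nq => [a b c d]; rewrite /qnorm2 /qrot /= mx3_det => nq.
(* The determinant of the homogeneous matrix is the cube of [qnorm2]. *)
by rewrite -[RHS](expr1n _ 3) -[in RHS]nq; ring.
Qed.

(** The kernel of the double cover is {1, -1}: the diagonal of the identity matrix and the unit norm
    leave only the real part of conj(p) q. *)
Lemma qrot_eq p q : qnorm2 p = 1 -> qnorm2 q = 1 -> qrot p = qrot q ->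
  q = p \/ q = qopp p.
Proof.
move=> np nq epq; pose r := qmul (qconj p) q.
have nr : qnorm2 r = 1 by rewrite qnorm2M qnorm2_conj np nq mulr1.
have rot_r : qrot r = 1%:M by rewrite qrotM qrot_conj -epq qrot_orthogonal.
have -> : q = qmul p r.
  have np1 : qnorm2 p = 1 := np; rewrite /qnorm2 in np1.
  rewrite /r; case: (p) (q) np1 => [a b c d] [a' b' c' d'] /= np1.
  by rewrite /qmul /qconj /=; congr Quat; rewrite -[LHS]mul1r -np1; ring.
case: r nr rot_r => [a b c d]; rewrite /qnorm2 /= mx3_scalar => nr.
move=> /mx3_inj[[e11 _ _] [_ e22 _] [_ _ e33]].
have b0 : b = 0 by apply/eqP; rewrite -sqrf_eq0; apply/eqP; lra.
have c0 : c = 0 by apply/eqP; rewrite -sqrf_eq0; apply/eqP; lra.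
have d0 : d = 0 by apply/eqP; rewrite -sqrf_eq0; apply/eqP; lra.
have /eqP : a ^+ 2 = 1 by lra.
rewrite sqrf_eq1 b0 c0 d0 => /orP[]/eqP ->; [left|right];
  case: (p) => [? ? ? ?]; rewrite /qmul /qopp /=; congr Quat; ring.
Qed.

Definition so3_mx (s1 s2 s3 : R) : 'M[R]_3 :=
  mx3 [:: [:: 0; - s3; s2]; [:: s3; 0; - s1]; [:: - s2; s1; 0]].

Lemma so3P (S : 'M[R]_3) : so3 S ->
  exists phi n1 n2 n3, n1 ^+ 2 + n2 ^+ 2 + n3 ^+ 2 = 1 /\
    S = phi *: so3_mx n1 n2 n3.
Proof.
have [a [b [c [d [e [f [g [h [i ->]]]]]]]]] := mx3_eta S.
rewrite /so3 /= mx3_tr mx3_opp.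
move=> /mx3_inj[[? ? ?] [? ? ?] [? ? ?]].
have -> : a = 0 by lra. have -> : e = 0 by lra. have -> : i = 0 by lra.
have -> : b = - d by lra. have -> : f = - h by lra. have -> : g = - c by lra.
have [z|nz] := eqVneq (h ^+ 2 + c ^+ 2 + d ^+ 2) 0.
  have [h0 c0 d0] : [/\ h = 0, c = 0 & d = 0].
    by split; apply/eqP; rewrite -sqrf_eq0; apply/eqP;
      have := sqr_ge0 h; have := sqr_ge0 c; have := sqr_ge0 d; lra.
  (* The zero matrix has no axis; any unit vector serves, with angle 0. *)
  exists 0, 1, 0, 0; split; first by ring.
  by rewrite scale0r h0 c0 d0 !oppr0; apply/matrixP =>
    -[[|[|[|//]]] ?] [[|[|[|//]]] ?]; rewrite !mxE.
pose r := Num.sqrt (h ^+ 2 + c ^+ 2 + d ^+ 2).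
have ge0 : 0 <= h ^+ 2 + c ^+ 2 + d ^+ 2 by rewrite !addr_ge0 ?sqr_ge0.
have r2 : r ^+ 2 = h ^+ 2 + c ^+ 2 + d ^+ 2 by rewrite sqr_sqrtr.
have r0 : r != 0 by rewrite -sqrf_eq0 r2.
exists r, (h / r), (c / r), (d / r); split.
  by rewrite !expr_div_n -!mulrDl r2 divff.
rewrite /so3_mx mx3_scale !mulr0 !mulrN.
by congr (mx3 [:: [:: _; _; _]; [:: _; _; _]; [:: _; _; _]]); field.
Qed.

Lemma so3_mx_cube (n1 n2 n3 : R) : n1 ^+ 2 + n2 ^+ 2 + n3 ^+ 2 = 1 ->
  so3_mx n1 n2 n3 ^+ 3 = - so3_mx n1 n2 n3.
Proof.
move=> n_unit; rewrite !exprS expr0 mulr1 -!mulmxE /so3_mx !mx3_mul mx3_opp.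
have e : n1 ^+ 2 = 1 - n2 ^+ 2 - n3 ^+ 2 by lra.
by congr (mx3 [:: [:: _; _; _]; [:: _; _; _]; [:: _; _; _]]); ring: e.
Qed.

(** Since N^3 = -N, every positive power is a signed N or N^2, and the exponential series splits
    into the sine series and the cosine series. *)
Lemma expm_unit (N : 'M[R]_3) (phi : R) : N ^+ 3 = - N ->
  expm (phi *: N) = 1 + sin phi *: N + (1 - cos phi) *: N ^+ 2.
Proof.
move=> N3.
have odd_pow j : N ^+ j.*2.+1 = (-1) ^+ j *: N.
  elim: j => [|j IH]; first by rewrite expr1 expr0 scale1r.
  rewrite doubleS -[X in N ^+ X]addn2 exprD IH -scalerAl -exprS N3.
  by rewrite exprS mulN1r scaleNr scalerN.
have even_pow j : N ^+ j.+1.*2 = (-1) ^+ j *: N ^+ 2.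
  by rewrite doubleS exprS odd_pow -scalerAr -expr2.
(* The term k = 0 is 1, not -N^2; the Kronecker delta corrects both places. *)
have termE k : (k`!%:R)^-1 *: (phi *: N) ^+ k =
    (k == 0)%:R *: 1 + sin_coeff phi k *: N
    + ((k == 0)%:R - cos_coeff phi k) *: N ^+ 2.
  rewrite exprZn scalerA /sin_coeff /cos_coeff /=.
  have := odd_double_half k; case: (odd k) => /= [|]; last first.
    rewrite add0n => <-; case: (k./2) => [|j].
      rewrite !expr0 fact0 !mul0r scale0r addr0 invr1 !mul1r double0 eqxx.
      by rewrite subrr scale0r addr0 scale1r.
    rewrite even_pow !mul0r doubleK mul1r /= !scale0r !add0r.
    rewrite scalerA -exprnP; congr (_ *: _).
    by move: (_ ^-1) (phi ^+ _) => u v; rewrite exprS; ring.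
  rewrite add1n => <-; rewrite /= doubleK odd_pow !mul0r subr0 !scale0r add0r.
  by rewrite addr0 mul1r scalerA; congr (_ *: _); ring.
(* After the shift by one, every partial sum contains k = 0, so the deltas add up to exactly 1. *)
rewrite /expm; apply: cvg_lim => //; rewrite -cvg_shiftS.
rewrite (_ : [sequence _]_n = fun n : nat => 1 + series (sin_coeff phi) n.+1 *: N
    + (1 - series (cos_coeff phi) n.+1) *: N ^+ 2); last first.
  apply/funext => n; rewrite /series /=.
  have delta_sum : \sum_(0 <= k < n.+1) (k == 0)%:R = 1 :> R.
    by rewrite big_nat_recl //= big1 ?addr0.
  rewrite (eq_bigr _ (fun k _ => termE k)) !big_split /= -!scaler_suml.
  by rewrite sumrB delta_sum scale1r.
have sin_cvg : series (sin_coeff phi) n.+1 @[n --> \oo] --> sin phi.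
  rewrite (cvg_shiftS (series (sin_coeff phi))) unlock.
  exact: is_cvg_series_sin_coeff.
have cos_cvg : series (cos_coeff phi) n.+1 @[n --> \oo] --> cos phi.
  rewrite (cvg_shiftS (series (cos_coeff phi))) unlock.
  exact: is_cvg_series_cos_coeff.
have cst_cvg (T : topologicalType) (x : T) : (fun _ : nat => x) n @[n --> \oo] --> x.
  exact: cvg_cst.
have := cvgD (cvgD (cst_cvg _ (1 : 'M[R]_3)) (cvgZr_tmp (a := N) sin_cvg))
  (cvgZr_tmp (a := N ^+ 2) (cvgB (cst_cvg _ (1 : R)) cos_cvg)).
exact.
Qed.

Lemma expm_qrot (phi n1 n2 n3 : R) : n1 ^+ 2 + n2 ^+ 2 + n3 ^+ 2 = 1 ->
  let s := sin (phi / 2) in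
  expm (phi *: so3_mx n1 n2 n3) = qrot (Quat (cos (phi / 2)) (s * n1) (s * n2) (s * n3)).
Proof.
move=> n_unit s; rewrite expm_unit ?so3_mx_cube //.
have e : phi = phi / 2 + phi / 2 by field.
rewrite {1 2}e sinD cosD -/s; set c := cos (phi / 2).
have cs : c ^+ 2 = 1 - s ^+ 2 by rewrite -(cos2Dsin2 (phi / 2)) addrK.
have nn : n1 ^+ 2 = 1 - n2 ^+ 2 - n3 ^+ 2 by lra.
rewrite expr2 -mulmxE /so3_mx mx3_mul !mx3_scale -[1]/(1%:M) mx3_scalar !mx3_add.
by congr (mx3 [:: [:: _; _; _]; [:: _; _; _]; [:: _; _; _]]); ring: cs nn.
Qed.

Definition qz (t : R) := Quat (cos (t / 2)) 0 0 (sin (t / 2)).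
Definition qy (t : R) := Quat (cos (t / 2)) 0 (sin (t / 2)) 0.

Lemma rot_zE t : rot_z t = qrot (qz t).
Proof.
have -> : rot_z t = expm (t *: so3_mx 0 0 1) by rewrite /so3_mx oppr0.
by rewrite expm_qrot ?mulr0 ?mulr1 //; ring.
Qed.

Lemma rot_yE t : rot_y t = qrot (qy t).
Proof.
have -> : rot_y t = expm (t *: so3_mx 0 1 0) by rewrite /so3_mx oppr0.
by rewrite expm_qrot ?mulr0 ?mulr1 //; ring.
Qed.

Definition qeuler (alpha beta gamma : R) :=
  qmul (qmul (qz alpha) (qy beta)) (qz gamma).

Lemma eulerE alpha beta gamma : euler alpha beta gamma = qrot (qeuler alpha beta gamma).
Proof. by rewrite /euler !rot_zE rot_yE -!qrotM. Qed.

Lemma qnorm2_euler alpha beta gamma : qnorm2 (qeuler alpha beta gamma) = 1.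
Proof.
rewrite /qeuler !qnorm2M /qnorm2 /=.
by rewrite !expr0n /= !addr0 !cos2Dsin2 !mulr1.
Qed.

End Quaternion.

(** * Euler angles *)

Section EulerAngles.
Context {R : realType}.

(** The case r = 0 is the one met at the poles, where any angle will do. *)
Lemma polar_angle (r u v : R) : 0 <= r -> u ^+ 2 + v ^+ 2 = r ^+ 2 ->
  exists t, u = r * cos t /\ v = r * sin t.
Proof.
move=> r_ge0 uv; have [r0|r_neq0] := eqVneq r 0.
  have u2 := sqr_ge0 u; have v2 := sqr_ge0 v.
  rewrite r0 expr0n /= in uv; exists 0; rewrite r0 !mul0r.
  by split; apply/eqP; rewrite -sqrf_eq0; apply/eqP; lra.
have r_gt0 : 0 < r by rewrite lt_def r_neq0.
have ur : u / r \in `[(-1), 1].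
  rewrite in_itv /= -ler_norml normf_div (gtr0_norm r_gt0) ler_pdivrMr // mul1r.
  rewrite -(ler_pXn2r (ltn0Sn 1)) ?nnegrE // real_normK ?num_real //.
  by rewrite -uv lerDl sqr_ge0.
have ur' : -1 <= u / r <= 1 by rewrite in_itv in ur.
have sinE : sin (acos (u / r)) = `|v| / r.
  have vr_ge0 : 0 <= `|v| / r by rewrite divr_ge0.
  rewrite sin_acos // -[RHS](ger0_norm vr_ge0) -sqrtr_sqr.
  congr Num.sqrt; rewrite !expr_div_n real_normK ?num_real //.
  have -> : v ^+ 2 = r ^+ 2 - u ^+ 2 by rewrite -uv addrC addKr.
  by field.
have [v_ge0|v_lt0] := leP 0 v; [exists (acos (u / r))|exists (- acos (u / r))];
  rewrite ?cosN ?sinN (acosK ur) sinE ?(ger0_norm v_ge0) ?(ltr0_norm v_lt0);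
  split; by field.
Qed.

Lemma double_angle (t : R) :
  cos t = cos (t / 2) ^+ 2 - sin (t / 2) ^+ 2 /\
  sin t = 2 * (cos (t / 2) * sin (t / 2)).
Proof.
have e : t = t / 2 + t / 2 by field.
by rewrite {1 4}e cosD sinD; split; ring.
Qed.

Lemma rot_z_mx3 (t : R) : rot_z t =
  mx3 [:: [:: cos t; - sin t; 0]; [:: sin t; cos t; 0]; [:: 0; 0; 1]].
Proof.
have [-> ->] := double_angle t; rewrite rot_zE /qrot /=.
have e : cos (t / 2) ^+ 2 = 1 - sin (t / 2) ^+ 2.
  by have := cos2Dsin2 (t / 2); lra.
by congr (mx3 [:: [:: _; _; _]; [:: _; _; _]; [:: _; _; _]]); ring: e.
Qed.

Lemma rot_y_mx3 (t : R) : rot_y t =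
  mx3 [:: [:: cos t; 0; sin t]; [:: 0; 1; 0]; [:: - sin t; 0; cos t]].
Proof.
have [-> ->] := double_angle t; rewrite rot_yE /qrot /=.
have e : cos (t / 2) ^+ 2 = 1 - sin (t / 2) ^+ 2.
  by have := cos2Dsin2 (t / 2); lra.
by congr (mx3 [:: [:: _; _; _]; [:: _; _; _]; [:: _; _; _]]); ring: e.
Qed.

Lemma SO3_mul (M N : 'M[R]_3) : SO3 M -> SO3 N -> SO3 (M *m N).
Proof.
move=> [M1 dM] [N1 dN]; split; last by rewrite det_mulmx dM dN mulr1.
by rewrite trmx_mul mulmxA -(mulmxA M) N1 mulmx1.
Qed.

Lemma SO3_tr (M : 'M[R]_3) : SO3 M -> SO3 M^T.
Proof. by move=> [M1 dM]; split; rewrite ?det_tr // trmxK; exact: mulmx1C. Qed.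

Lemma SO3_fix_z (a b d e g h : R) :
  SO3 (mx3 [:: [:: a; b; 0]; [:: d; e; 0]; [:: g; h; 1]]) ->
  exists t, mx3 [:: [:: a; b; 0]; [:: d; e; 0]; [:: g; h; 1]] = rot_z t.
Proof.
move=> [orth]; rewrite mx3_det => det1; move: orth.
rewrite mx3_tr mx3_mul mx3_scalar => /mx3_inj[[r11 r12 _] [_ r22 _] [_ _ r33]].
have [g2 h2] := (sqr_ge0 g, sqr_ge0 h).
have g0 : g = 0 by apply/eqP; rewrite -sqrf_eq0; apply/eqP; lra.
have h0 : h = 0 by apply/eqP; rewrite -sqrf_eq0; apply/eqP; lra.
(* The left side is the sum of the squared lengths of the first two rows minus twice the
   determinant, that is 1 + 1 - 2. *)
have sq0 : (a - e) ^+ 2 + (b + d) ^+ 2 = 0.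
  have -> : (a - e) ^+ 2 + (b + d) ^+ 2 = (a * a + b * b + 0 * 0) +
    (d * d + e * e + 0 * 0) - 2 * (a * (e * 1 - 0 * h) - b * (d * 1 - 0 * g) +
    0 * (d * h - e * g)) by ring.
  by rewrite det1 r11 r22; ring.
have [ae2 bd2] := (sqr_ge0 (a - e), sqr_ge0 (b + d)).
have ae : a - e = 0 by apply/eqP; rewrite -sqrf_eq0; apply/eqP; lra.
have bd : b + d = 0 by apply/eqP; rewrite -sqrf_eq0; apply/eqP; lra.
have {}ae : e = a by lra. have {}bd : b = - d by lra.
have ad : a ^+ 2 + d ^+ 2 = 1 ^+ 2.
  rewrite expr1n -r11 bd; ring.
have [t [ct st]] := polar_angle ler01 ad.
by exists t; rewrite rot_z_mx3 bd ae g0 h0 ct st !mul1r.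
Qed.

(** The third column of M is a point of the sphere and yields alpha and beta as its spherical
    coordinates; what remains of M fixes the z-axis and yields gamma. *)
Lemma euler_angles_exist (M : 'M[R]_3) : SO3 M -> exists w, is_euler_angles M w.
Proof.
move=> MSO; have [a [b [c [d [e [f [g [h [i E]]]]]]]]] := mx3_eta M.
have := (MSO); have [/mulmx1C cols _] := MSO; move: cols.
rewrite {1 2}E mx3_tr mx3_mul mx3_scalar => /mx3_inj[_ _ [_ _ col3]] _.
have [c2 [f2 i2]] := (sqr_ge0 c, (sqr_ge0 f, sqr_ge0 i)).
have i1 : -1 <= i <= 1.
  rewrite -ler_norml -(ler_pXn2r (ltn0Sn 1)) ?nnegrE // real_normK ?num_real //.
  by rewrite expr1n; lra.
have r_ge0 : 0 <= sin (acos i) by rewrite sin_acos ?sqrtr_ge0.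
have cf : c ^+ 2 + f ^+ 2 = sin (acos i) ^+ 2.
  by rewrite sin_acos // sqr_sqrtr; lra.
have [alpha [c_eq f_eq]] := polar_angle r_ge0 cf.
pose Q := rot_z alpha *m rot_y (acos i).
have QSO : SO3 Q.
  apply: SO3_mul; rewrite ?rot_zE ?rot_yE; apply: qrot_SO3; rewrite /qnorm2 /=;
  by rewrite expr0n /= ?addr0 cos2Dsin2.
have := SO3_mul (SO3_tr QSO) MSO.
have cosi : cos (acos i) = i by rewrite acosK // in_itv.
have ei : i ^+ 2 + sin (acos i) ^+ 2 = 1 by rewrite -[X in X ^+ 2 + _]cosi cos2Dsin2.
have ea := cos2Dsin2 alpha.
(* Q maps the z-axis to the third column of M, so the third column of [Q^T *m M] is that of the
   identity. *)
have QM : exists a' b' d' e' g' h',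
    Q^T *m M = mx3 [:: [:: a'; b'; 0]; [:: d'; e'; 0]; [:: g'; h'; 1]].
  rewrite /Q rot_z_mx3 rot_y_mx3 E mx3_mul mx3_tr mx3_mul cosi c_eq f_eq.
  set s := sin (acos i) in ei *; set ca := cos alpha in ea *; set sa := sin alpha in ea *.
  have ei' : i ^+ 2 = 1 - s ^+ 2 by lra. have ea' : ca ^+ 2 = 1 - sa ^+ 2 by lra.
  do 6! eexists.
  by congr (mx3 [:: [:: _; _; _]; [:: _; _; _]; [:: _; _; _]]); ring: ei' ea'.
have [? [? [? [? [? [? QME]]]]]] := QM.
rewrite QME => /SO3_fix_z [gamma]; rewrite -QME => Ez.
exists (alpha, acos i, gamma); split; first by rewrite acos_ge0 ?acos_lepi.
by rewrite /euler -/Q -Ez mulmxA; case: QSO => -> _; rewrite mul1mx.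
Qed.

End EulerAngles.

(** * Matrix coefficients as polynomial coefficients *)

Section CoefficientFunction.
Context {T : comNzRingType}.

Definition cfun (m n J : nat) (x y z w : T) : T :=
  ((x *: 'X + z%:P) ^+ m * (y *: 'X + w%:P) ^+ n)`_J.

Lemma coef_linear_exp (x z : T) (m i : nat) :
  ((x *: 'X + z%:P) ^+ m)`_i = 'C(m, i)%:R * x ^+ i * z ^+ (m - i).
Proof.
rewrite addrC exprDn coef_sum.
have coefE (j : 'I_m.+1) : (z%:P ^+ (m - j) * (x *: 'X) ^+ j *+ 'C(m, j))`_i =
    if i == j then 'C(m, i)%:R * x ^+ i * z ^+ (m - i) else 0.
  rewrite coefMn -rmorphXn /= coefCM exprZn coefZ coefXn.
  by case: eqP => [->|_]; rewrite ?mulr0 ?mul0rn // mulr1 -mulr_natl; ring.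
rewrite (eq_bigr _ (fun j _ => coefE j)) -big_mkcond /=.
have [lt_im|le_mi] := ltnP i m.+1; first by rewrite (big_pred1 (Ordinal lt_im)).
rewrite bin_small // !mul0r big_pred0 // => j.
by apply/negbTE; rewrite neq_ltn orbC (leq_trans (ltn_ord j) le_mi).
Qed.

Lemma cfunE (m n J : nat) (x y z w : T) : cfun m n J x y z w =
  \sum_(i < J.+1) ('C(m, i)%:R * x ^+ i * z ^+ (m - i)) *
    ('C(n, J - i)%:R * y ^+ (J - i) * w ^+ (n - (J - i))).
Proof. by rewrite /cfun coefM; apply: eq_bigr => i _; rewrite !coef_linear_exp. Qed.

Lemma sum_window (J b S : nat) (f : nat -> T) : (b + S <= J)%N ->
  (forall i, (i <= J)%N -> (i < b)%N || (b + S < i)%N -> f i = 0) ->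
  \sum_(i < J.+1) f i = \sum_(j < S.+1) f (b + S - j)%N.
Proof.
move=> bSJ f0; rewrite -(big_mkord xpredT f).
rewrite (big_cat_nat (n := b)) //=; last by lia.
rewrite big1_seq ?add0r => [|i]; last first.
  by rewrite mem_index_iota => ib; apply: f0; lia.
rewrite (big_cat_nat (n := (b + S).+1)) /=; [|lia|lia].
rewrite [X in _ + X]big1_seq ?addr0 => [|i]; last first.
  by rewrite mem_index_iota => ib; apply: f0; lia.
rewrite -{1}[b]add0n big_addn big_nat_rev /= add0n.
have -> : ((b + S).+1 - b = S.+1)%N by lia.
rewrite big_mkord; apply: eq_bigr => j _; congr f.
by have := ltn_ord j; lia.
Qed.

(** The two binomials are both nonzero only for J - n <= i <= m. The window [b, b + S] contains
    these i, and it is traversed downwards because this is the order of the Jacobi sum. *)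
Lemma cfun_window (b S m n J : nat) (x y z w : T) :
  (b + S <= J)%N -> (b <= J - n)%N -> (minn m J <= b + S)%N ->
  cfun m n J x y z w = \sum_(j < S.+1)
    ('C(m, b + S - j)%:R * x ^+ (b + S - j) * z ^+ (m - (b + S - j))) *
    ('C(n, J - (b + S - j))%:R * y ^+ (J - (b + S - j)) *
     w ^+ (n - (J - (b + S - j)))).
Proof.
move=> bSJ bJn mJ; rewrite cfunE.
apply: (sum_window (f := fun i => ('C(m, i)%:R * x ^+ i * z ^+ (m - i)) *
    ('C(n, J - i)%:R * y ^+ (J - i) * w ^+ (n - (J - i))))) => // i iJ.
case/orP => ?; last by rewrite bin_small ?mul0r //; lia.
by rewrite [X in _ * X](_ : _ = 0) ?mulr0 // bin_small ?mul0r //; lia.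
Qed.

(** For s^2 + c^2 = 1 this is s^a c^b times the Jacobi polynomial at c^2 - s^2, where (x - 1) / 2 =
    -s^2 and (x + 1) / 2 = c^2; see [jacobi_wsum]. *)
Definition wsum (S a b : nat) (s c : T) : T := \sum_(j < S.+1)
  (-1) ^+ j * ('C(S + a, S - j) * 'C(S + b, j))%:R
  * s ^+ (a + j + j) * c ^+ (b + (S - j) + (S - j)).

Variables (S a b : nat) (s c : T).

(* With S = l - max(|k|, |k'|), a = |k - k'| and b = |k + k'|, the maximum is
   k, - k, k' or - k' in the lemmas [_top], [_bottom], [_right], [_left]. *)
Lemma cfun_wsum_top :
  cfun (S + b) (S + a) (S + a + b) c (- s) s c = (-1) ^+ a * wsum S a b s c.
Proof.
rewrite (cfun_window (b := b) (S := S)); [|lia|lia|lia].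
rewrite mulr_sumr; apply: eq_bigr => -[j /= jS] _.
have -> : (S + b - (b + S - j) = j)%N by lia.
have -> : (S + a + b - (b + S - j) = a + j)%N by lia.
have -> : (S + a - (a + j) = S - j)%N by lia.
have -> : 'C(S + b, b + S - j) = 'C(S + b, j).
  by rewrite -[RHS]bin_sub; [congr binomial; lia|lia].
have -> : 'C(S + a, a + j) = 'C(S + a, S - j).
  by rewrite -[RHS]bin_sub; [congr binomial; lia|lia].
have -> : (b + S - j = b + (S - j))%N by lia.
rewrite (exprNn s) natrM !exprD; ring.
Qed.

Lemma cfun_wsum_bottom :
  cfun (S + a) (S + b) S c (- s) s c = wsum S a b s c.
Proof.
rewrite (cfun_window (b := 0) (S := S)); [|lia|lia|lia].
apply: eq_bigr => -[j /= jS] _; rewrite add0n.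
have -> : (S + a - (S - j) = a + j)%N by lia.
have -> : (S - (S - j) = j)%N by lia.
have -> : (S + b - j = b + (S - j))%N by lia.
rewrite (exprNn s) natrM !exprD; ring.
Qed.

(** Both products of binomials have the denominator (a+j)! (S+b-j)! j! (S-j)!; only their numerators
    differ, and these do not involve j. *)
Lemma bin_mul_right (j : nat) : (j <= S)%N ->
  ((S + a)`! * (S + b)`! * ('C(S + a + b, a + j) * 'C(S, j)) =
   (S + a + b)`! * S`! * ('C(S + a, S - j) * 'C(S + b, j)))%N.
Proof.
move=> jS.
have e1 := @bin_fact (S + a + b) (a + j) ltac:(lia).
have e2 := @bin_fact S j jS.
have e3 := @bin_fact (S + a) (S - j) ltac:(lia).
have e4 := @bin_fact (S + b) j ltac:(lia).
rewrite (_ : S + a + b - (a + j) = S + b - j)%N in e1; last by lia.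
rewrite (_ : S + a - (S - j) = a + j)%N in e3; last by lia.
apply/eqP; rewrite -(@eqn_pmul2r ((a + j)`! * (S + b - j)`! * (j`! * (S - j)`!)));
  last by rewrite !muln_gt0 !fact_gt0.
apply/eqP; rewrite -[X in (_ = X * _ * _ * _)%N]e1 -[X in (_ = _ * X * _ * _)%N]e2.
rewrite -[X in (X * _ * _ * _ = _)%N]e3 -[X in (_ * X * _ * _ = _)%N]e4; ring.
Qed.

Lemma cfun_wsum_right :
  ((S + a)`! * (S + b)`!)%:R * cfun (S + a + b) S (S + b) c (- s) s c =
  ((S + a + b)`! * S`!)%:R * wsum S a b s c.
Proof.
rewrite (cfun_window (b := b) (S := S)); [|lia|lia|lia].
rewrite !mulr_sumr; apply: eq_bigr => -[j /= jS] _.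
have -> : (S + a + b - (b + S - j) = a + j)%N by lia.
have -> : (S + b - (b + S - j) = j)%N by lia.
have -> : 'C(S + a + b, b + S - j) = 'C(S + a + b, a + j).
  by rewrite -[RHS]bin_sub; [congr binomial; lia|lia].
have -> : (b + S - j = b + (S - j))%N by lia.
rewrite (exprNn s).
have /(congr1 (fun n => n%:R : T)) := bin_mul_right (j := j) ltac:(lia).
rewrite !natrM !exprD => e.
transitivity ((S + a)`!%:R * (S + b)`!%:R * ('C(S + a + b, a + j)%:R * 'C(S, j)%:R)
  * ((-1) ^+ j * (s ^+ a * s ^+ j * s ^+ j) * (c ^+ b * c ^+ (S - j) * c ^+ (S - j)))).
  ring.
rewrite e; ring.
Qed.

Lemma cfun_wsum_left :
  ((S + a)`! * (S + b)`!)%:R * cfun S (S + a + b) (S + a) c (- s) s c =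
  ((S + a + b)`! * S`!)%:R * ((-1) ^+ a * wsum S a b s c).
Proof.
rewrite (cfun_window (b := 0) (S := S)); [|lia|lia|lia].
rewrite !mulr_sumr; apply: eq_bigr => -[j /= jS] _; rewrite add0n.
have -> : (S + a - (S - j) = a + j)%N by lia.
have -> : (S - (S - j) = j)%N by lia.
have -> : (S + a + b - (a + j) = b + (S - j))%N by lia.
rewrite bin_sub; last by lia.
rewrite (exprNn s).
have /(congr1 (fun n => n%:R : T)) := bin_mul_right (j := j) ltac:(lia).
rewrite !natrM !exprD => e.
transitivity ((S + a)`!%:R * (S + b)`!%:R * ('C(S + a + b, a + j)%:R * 'C(S, j)%:R)
  * ((-1) ^+ a * (-1) ^+ j * (s ^+ a * s ^+ j * s ^+ j)
     * (c ^+ b * c ^+ (S - j) * c ^+ (S - j)))).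
  ring.
rewrite e; ring.
Qed.

End CoefficientFunction.

(** * Wigner-d functions as normalized polynomial coefficients *)

Section WignerSmallD.
Context {R : realType}.

(** The change from monomials to the orthonormal basis X^J / sqrt(J! (N-J)!) of binary forms of
    degree N, for an SU(2)-invariant inner product. *)
Definition wnorm (N J m : nat) : R :=
  Num.sqrt ((J`! * (N - J)`!)%:R / (m`! * (N - m)`!)%:R).

(** This covers s = 0 as well: the convention that 0 to the real power 0 is 1 agrees with [s ^+ 0],
    which is what happens at the poles. *)
Lemma sqrtr_powR (s : R) (a : nat) : 0 <= s -> (s ^+ 2) `^ (a%:R / 2) = s ^+ a.
Proof.
move=> s0; rewrite mulrC powRrM powR12_sqrt ?sqr_ge0 // sqrtr_sqr ger0_norm //.
exact: powR_mulrn.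
Qed.

Lemma jacobi_wsum (S a b : nat) (s c : R) : s ^+ 2 + c ^+ 2 = 1 ->
  s ^+ a * c ^+ b * (jacobi S a b).[c ^+ 2 - s ^+ 2] = wsum S a b s c.
Proof.
move=> sc; have e : c ^+ 2 = 1 - s ^+ 2 by lra.
rewrite /jacobi horner_sum mulr_sumr; apply: eq_bigr => j _.
rewrite !hornerE.
have -> : 2^-1 * (c ^+ 2 - s ^+ 2 - 1) = (-1) * (s * s).
  by rewrite e -[s * s]expr2; field.
have -> : 2^-1 * (c ^+ 2 - s ^+ 2 + 1) = c * c.
  by rewrite -[c * c]expr2 e; field.
by rewrite /= !exprMn !exprD; ring.
Qed.

Lemma wconst_sq (S a b : nat) :
  'C(S + a + b, S + a)%:R / 'C(S + b, b)%:R =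
  ((S + a + b)`! * S`!)%:R / ((S + a)`! * (S + b)`!)%:R :> R.
Proof.
have e1 := @bin_fact (S + a + b) (S + a) ltac:(lia).
have e2 := @bin_fact (S + b) b ltac:(lia).
rewrite addKn in e1; rewrite addnK in e2.
have fact_neq0 n : n`!%:R != 0 :> R by rewrite pnatr_eq0 -lt0n fact_gt0.
have bin_neq0 : 'C(S + b, b)%:R != 0 :> R.
  by rewrite pnatr_eq0 -lt0n bin_gt0 leq_addl.
rewrite -e1 -e2 !natrM; field.
by rewrite !fact_neq0 bin_neq0.
Qed.

Lemma signz_absdiff (k k' : int) : k' < k ->
  (-1) ^ (k + k') = (-1) ^+ `|k - k'|%N :> R.
Proof.
move=> kk; have -> : k + k' = `|k - k'|%N%:Z + 2%N%:Z * k' by lia.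
by rewrite expfzDr ?oppr_eq0 ?oner_eq0 // mulrC -exprz_exp -!exprnP sqrrN expr1n exp1rz mul1r.
Qed.

Lemma sqrt_div_mul (x y : R) : 0 < x -> 0 < y ->
  Num.sqrt (x / y) * y = Num.sqrt (y / x) * x.
Proof.
move=> x0 y0.
have hx : Num.sqrt x ^+ 2 = x by rewrite sqr_sqrtr ?ltW.
have hy : Num.sqrt y ^+ 2 = y by rewrite sqr_sqrtr ?ltW.
have x1 : Num.sqrt x != 0 by rewrite gt_eqF // sqrtr_gt0.
have y1 : Num.sqrt y != 0 by rewrite gt_eqF // sqrtr_gt0.
rewrite !sqrtrM ?sqrtrV ?ltW // -[X in _ * X = _]hy -[X in _ = _ * X]hx; field.
by rewrite x1 y1.
Qed.

Lemma wigner_dE (l : nat) (k k' : int) (beta : R) :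
  (`|k| <= l)%N -> (`|k'| <= l)%N -> 0 <= beta <= pi ->
  let J := `|(l%:Z + k)%R|%N in let m := `|(l%:Z + k')%R|%N in
  let s := sin (beta / 2) in let c := cos (beta / 2) in
  wigner_d l k k' (cos beta) = wnorm (2 * l) J m * cfun m (2 * l - m) J c (- s) s c.
Proof.
move=> hk hk' /andP[beta0 betapi] J m s c.
(* The range of beta makes both half-angle values nonnegative, so the real powers in [wigner_d] are
   powers of s and c themselves. *)
have s0 : 0 <= s by apply: sin_ge0_pi; lra.
have c0 : 0 <= c by apply: cos_ge0_pihalf; lra.
have sc : s ^+ 2 + c ^+ 2 = 1 by rewrite addrC cos2Dsin2.
have c2 : c ^+ 2 = 1 - s ^+ 2 by lra.
have [cosE _] := double_angle beta.
rewrite /wigner_d.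
set a := `|(k - k')%R|%N; set b := `|(k + k')%R|%N; set S := (l - maxn _ _)%N.
have -> : (1 - cos beta) / 2 = s ^+ 2 by rewrite cosE -/s -/c c2; field.
have -> : (1 + cos beta) / 2 = c ^+ 2 by rewrite cosE -/s -/c c2; field.
rewrite !sqrtr_powR // cosE -/s -/c -[_ * s ^+ a * c ^+ b]mulrA.
rewrite -[_ * (_ * _) * _]mulrA jacobi_wsum // -[_ * Num.sqrt _ / _]mulrA.
(* Indeed a + b is twice the maximum of |k| and |k'|. *)
have -> : (2 * l - S = S + a + b)%N by lia.
rewrite -sqrtrV // -sqrtrM // wconst_sq.
have fact_pos i j : 0 < (i`! * j`!)%:R :> R by rewrite ltr0n muln_gt0 !fact_gt0.
set W := wsum S a b s c.
have sgnE : (-1) ^ (if k' < k then k + k' else 0) =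
    (if k' < k then (-1) ^+ a else 1) :> R.
  by case: ifP => // kk; rewrite signz_absdiff.
rewrite sgnE /wnorm.
(* The signs of k - k' and k + k' tell which of k, -k, k', -k' is the maximum. The factor (-1)^nu is
   the sign left over from the power of the entry -s; a tie k = k' joins the first branch, where a =
   0 makes the sign trivial. *)
have [kk'|k'k] := leP k' k.
  have -> : (if k' < k then (-1) ^+ a else 1) = (-1) ^+ a :> R.
    by case: ltP => // k'k; rewrite (_ : a = 0)%N //; lia.
  have [kmax|kmin] := leP 0 (k + k').
    have -> : (J = S + a + b)%N by lia.
    have -> : (m = S + b)%N by lia.
    have -> : (2 * l - (S + a + b) = S)%N by lia.
    have -> : (2 * l - (S + b) = S + a)%N by lia.
    by rewrite cfun_wsum_top -/W [X in _ = Num.sqrt (_ / X%:R) * _]mulnC; ring.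
  have -> : (J = S + a)%N by lia.
  have -> : (m = S)%N by lia.
  have -> : (2 * l - (S + a) = S + b)%N by lia.
  have -> : (2 * l - S = S + a + b)%N by lia.
  apply: (mulfI (lt0r_neq0 (fact_pos (S + a)%N (S + b)%N))).
  rewrite [RHS]mulrCA cfun_wsum_left -/W [in RHS](mulnC S`!).
  by rewrite [RHS]mulrA sqrt_div_mul //; ring.
have -> : (if k' < k then (-1) ^+ a else 1) = 1 :> R by rewrite ltNge (ltW k'k).
have [kmax|kmin] := leP 0 (k + k').
  have -> : (J = S + b)%N by lia.
  have -> : (m = S + a + b)%N by lia.
  have -> : (2 * l - (S + b) = S + a)%N by lia.
  have -> : (2 * l - (S + a + b) = S)%N by lia.
  apply: (mulfI (lt0r_neq0 (fact_pos (S + a)%N (S + b)%N))).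
  rewrite [RHS]mulrCA cfun_wsum_right -/W [in RHS](mulnC (S + b)`!).
  by rewrite [RHS]mulrA sqrt_div_mul //; ring.
have -> : (J = S)%N by lia.
have -> : (m = S + a)%N by lia.
have -> : (2 * l - S = S + a + b)%N by lia.
have -> : (2 * l - (S + a) = S + b)%N by lia.
by rewrite cfun_wsum_bottom -/W [in RHS](mulnC S`!); ring.
Qed.

End WignerSmallD.

(** * Diagonal actions on the coefficients *)

Section Homogeneity.

(** Multiplying the 2 x 2 matrix by diag(u, v) on the left and diag(g, h) on the right scales the
    coefficient by a character. This yields both the exponentials in alpha and gamma and the
    behaviour under q -> -q. *)
Lemma cfun_scale (T : comNzRingType) (m n J : nat) (u v g h x y z w : T) :
  (J <= m + n)%N ->
  cfun m n J (u * g * x) (u * h * y) (v * g * z) (v * h * w) =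
  u ^+ J * v ^+ (m + n - J) * g ^+ m * h ^+ n * cfun m n J x y z w.
Proof.
move=> JN; rewrite !cfunE mulr_sumr; apply: eq_bigr => -[i /= iJ] _.
have [im|mi] := leqP i m; last by rewrite bin_small // !mul0r mulr0.
have [Jn|nJ] := leqP (J - i) n; last first.
  by rewrite (@bin_small n) // !mul0r !mulr0.
have -> : u ^+ J = u ^+ i * u ^+ (J - i) by rewrite -exprD subnKC.
have -> : v ^+ (m + n - J) = v ^+ (m - i) * v ^+ (n - (J - i)).
  by rewrite -exprD; congr (_ ^+ _); lia.
have -> : g ^+ m = g ^+ i * g ^+ (m - i) by rewrite -exprD subnKC.
have -> : h ^+ n = h ^+ (J - i) * h ^+ (n - (J - i)) by rewrite -exprD subnKC.
rewrite !exprMn; ring.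
Qed.

Lemma cfun_map (T T' : comNzRingType) (f : {rmorphism T -> T'}) (m n J : nat)
    (x y z w : T) :
  cfun m n J (f x) (f y) (f z) (f w) = f (cfun m n J x y z w).
Proof.
rewrite !cfunE rmorph_sum; apply: eq_bigr => i _.
by rewrite !rmorphM !rmorphXn !rmorph_nat.
Qed.

End Homogeneity.

(** * Wigner-D functions on unit quaternions *)

Section WignerFunction.
Context {R : realType}.
Implicit Types (p q : @quat R) (t : R).

(* Entries of the SU(2) matrix q0 - i (q1 sigma_x + q2 sigma_y + q3 sigma_z). *)
Definition u11 q : R[i] := (q0 q +i* - q3 q)%C.
Definition u12 q : R[i] := (- q2 q +i* - q1 q)%C.
Definition u21 q : R[i] := (q2 q +i* - q1 q)%C.
Definition u22 q : R[i] := (q0 q +i* q3 q)%C.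

Lemma u11M p q : u11 (qmul p q) = u11 p * u11 q + u12 p * u21 q.
Proof. by apply/eqP; rewrite eq_complex /=; apply/andP; split; apply/eqP; ring. Qed.
Lemma u12M p q : u12 (qmul p q) = u11 p * u12 q + u12 p * u22 q.
Proof. by apply/eqP; rewrite eq_complex /=; apply/andP; split; apply/eqP; ring. Qed.
Lemma u21M p q : u21 (qmul p q) = u21 p * u11 q + u22 p * u21 q.
Proof. by apply/eqP; rewrite eq_complex /=; apply/andP; split; apply/eqP; ring. Qed.
Lemma u22M p q : u22 (qmul p q) = u21 p * u12 q + u22 p * u22 q.
Proof. by apply/eqP; rewrite eq_complex /=; apply/andP; split; apply/eqP; ring. Qed.

Definition uM := (u11M, u12M, u21M, u22M).

Definition wfun (N J m : nat) q : R[i] :=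
  (wnorm N J m)%:C%C * cfun m (N - m) J (u11 q) (u12 q) (u21 q) (u22 q).

(** The total degree N is even: this is what lets the function descend from SU(2) to SO(3). *)
Lemma wfun_opp (N J m : nat) q : ~~ odd N -> (J <= N)%N -> (m <= N)%N ->
  wfun N J m (qopp q) = wfun N J m q.
Proof.
move=> evenN JN mN; apply: (congr1 ( *%R _)).
have uN (x y : R) : ((- x) +i* (- y))%C = -1 * 1 * (x +i* y)%C.
  by rewrite mulr1 mulN1r.
rewrite /u11 /u12 /u21 /u22 /= -[q3 q in X in cfun _ _ _ _ _ _ X]opprK !uN.
rewrite cfun_scale subnKC // ?expr1n ?mulr1 -?exprD ?subnKC //.
by rewrite -signr_odd (negbTE evenN) mul1r opprK.
Qed.

Lemma expiD (s t : R) : expi (s + t) = expi s * expi t.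
Proof.
by apply/eqP; rewrite eq_complex /= cosD sinD; apply/andP; split; apply/eqP; ring.
Qed.

Lemma expi0 : expi 0 = 1 :> R[i].
Proof. by rewrite /expi cos0 sin0. Qed.

Lemma expiX (t : R) n : expi t ^+ n = expi (n%:R * t).
Proof.
elim: n => [|n IH]; first by rewrite expr0 mul0r expi0.
by rewrite exprS IH -expiD; congr expi; rewrite -natr1; ring.
Qed.

Lemma wfun_euler (l : nat) (k k' : int) (alpha beta gamma : R) :
  (`|k| <= l)%N -> (`|k'| <= l)%N -> 0 <= beta <= pi ->
  (Num.sqrt ((2 * l + 1)%:R))%:C%C *
    wfun (2 * l) `|(l%:Z + k)%R| `|(l%:Z + k')%R| (qeuler alpha beta gamma) =
  wignerD_angles l k k' alpha beta gamma.
Proof.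
move=> hk hk' hbeta; rewrite /wignerD_angles wigner_dE //.
set J := `|_|%N; set m := `|_|%N; set s := sin (beta / 2); set c := cos (beta / 2).
have JN : (J <= 2 * l)%N by lia.
have mN : (m <= 2 * l)%N by lia.
rewrite /wfun.
have -> : u11 (qeuler alpha beta gamma) =
    expi (- (alpha / 2)) * expi (- (gamma / 2)) * c%:C%C.
  rewrite /qeuler !uM /u11 /u12 /u21 /u22 /expi /= !cosN !sinN -/c -/s.
  by apply/eqP; rewrite eq_complex /=; apply/andP; split; apply/eqP; ring.
have -> : u12 (qeuler alpha beta gamma) =
    expi (- (alpha / 2)) * expi (gamma / 2) * (- s)%:C%C.
  rewrite /qeuler !uM /u11 /u12 /u21 /u22 /expi /= !cosN !sinN -/c -/s.
  by apply/eqP; rewrite eq_complex /=; apply/andP; split; apply/eqP; ring.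
have -> : u21 (qeuler alpha beta gamma) =
    expi (alpha / 2) * expi (- (gamma / 2)) * s%:C%C.
  rewrite /qeuler !uM /u11 /u12 /u21 /u22 /expi /= !cosN !sinN -/c -/s.
  by apply/eqP; rewrite eq_complex /=; apply/andP; split; apply/eqP; ring.
have -> : u22 (qeuler alpha beta gamma) =
    expi (alpha / 2) * expi (gamma / 2) * c%:C%C.
  rewrite /qeuler !uM /u11 /u12 /u21 /u22 /expi /= -/c -/s.
  by apply/eqP; rewrite eq_complex /=; apply/andP; split; apply/eqP; ring.
rewrite cfun_scale subnKC // cfun_map rmorphM /=.
(* The exponents combine to (2l - J) - J = -2k half-angles. *)
have <- : expi (- (alpha / 2)) ^+ J * expi (alpha / 2) ^+ (2 * l - J) =
    expi (- (k%:~R * alpha)).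
  rewrite !expiX -expiD; congr expi.
  have -> : k%:~R = J%:R - l%:R :> R by rewrite !pmulrn -intrB; congr _%:~R; lia.
  by rewrite natrB // natrM; field.
have <- : expi (- (gamma / 2)) ^+ m * expi (gamma / 2) ^+ (2 * l - m) =
    expi (- (k'%:~R * gamma)).
  rewrite !expiX -expiD; congr expi.
  have -> : k'%:~R = m%:R - l%:R :> R by rewrite !pmulrn -intrB; congr _%:~R; lia.
  by rewrite natrB // natrM; field.
ring.
Qed.

(** Whichever angles [get] selects, their quaternion is q or -q, and [wfun] takes the same value at
    both; hence the formula also holds at the poles. *)
Lemma wignerD_wfun (l : nat) (k k' : int) q :
  (`|k| <= l)%N -> (`|k'| <= l)%N -> qnorm2 q = 1 ->
  wignerD l k k' (qrot q) = (Num.sqrt ((2 * l + 1)%:R))%:C%C *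
    wfun (2 * l) `|(l%:Z + k)%R| `|(l%:Z + k')%R| q.
Proof.
move=> hk hk' nq; rewrite /wignerD hk hk' /=.
have := getPex (euler_angles_exist (qrot_SO3 nq)).
case: (get _) => [[alpha beta] gamma] [hbeta]; rewrite eulerE => e.
rewrite -(wfun_euler alpha gamma hk hk' hbeta); apply: (congr1 ( *%R _)).
have JN (j : int) : (`|j| <= l)%N -> (`|(l%:Z + j)%R| <= 2 * l)%N by lia.
case: (qrot_eq nq (qnorm2_euler alpha beta gamma) e) => ->; first by [].
by apply: wfun_opp; [rewrite mul2n odd_double|exact: JN|exact: JN].
Qed.

End WignerFunction.

(** * Derivatives of complex-valued functions *)

Section ComplexDerivative.
Context {R : realType}.
Implicit Types (f g : R -> R[i]) (t : R) (a b c : R[i]).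

Definition cderiv f t a : Prop :=
  is_derive t (1 : R) (fun x => complex.Re (f x)) (complex.Re a) /\
  is_derive t (1 : R) (fun x => complex.Im (f x)) (complex.Im a).

Lemma cderiv_cst a t : cderiv (fun=> a) t 0.
Proof. by split; exact: is_derive_cst. Qed.

Lemma cderivD f g t a b : cderiv f t a -> cderiv g t b ->
  cderiv (fun x => f x + g x) t (a + b).
Proof.
by move=> [rf jf] [rg jg]; split; rewrite raddfD; under eq_fun do rewrite raddfD;
  exact: is_deriveD.
Qed.

Lemma cderivM f g t a b : cderiv f t a -> cderiv g t b ->
  cderiv (fun x => f x * g x) t (a * g t + f t * b).
Proof.
have ReD (x y : R[i]) : complex.Re (x + y) = complex.Re x + complex.Re y.
  exact: raddfD.
have ImD (x y : R[i]) : complex.Im (x + y) = complex.Im x + complex.Im y.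
  exact: raddfD.
have ReM (x y : R[i]) : complex.Re (x * y) =
    complex.Re x * complex.Re y - complex.Im x * complex.Im y by case: x; case: y.
have ImM (x y : R[i]) : complex.Im (x * y) =
    complex.Re x * complex.Im y + complex.Im x * complex.Re y by case: x; case: y.
move=> [rf jf] [rg jg]; split.
  under eq_fun do rewrite ReM.
  apply: is_derive_eq; rewrite ReD !ReM /GRing.scale /=; ring.
under eq_fun do rewrite ImM.
apply: is_derive_eq; rewrite ImD !ImM /GRing.scale /=; ring.
Qed.

End ComplexDerivative.

(** * Formal derivatives under row and column operations *)

Section Leibniz.
Context {T : comNzRingType}.

Definition dcfun (m n J : nat) (x y z w x' y' z' w' : T) : T :=
  (m%:R * (x *: 'X + z%:P) ^+ m.-1 * (x' *: 'X + z'%:P) * (y *: 'X + w%:P) ^+ n +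
   n%:R * (x *: 'X + z%:P) ^+ m * (y *: 'X + w%:P) ^+ n.-1 *
     (y' *: 'X + w'%:P))`_J.

(** The direction is a product with (a b; c d) on the right: it replaces each of the two linear
    forms by a combination of both, so the derivative regroups into products of their powers. *)
Lemma dcfun_columns (m n J : nat) (x y z w a b c d : T) :
  dcfun m n J x y z w (x * a + y * c) (x * b + y * d) (z * a + w * c) (z * b + w * d) =
  (m%:R * a + n%:R * d) * cfun m n J x y z w
  + m%:R * c * cfun m.-1 n.+1 J x y z w + n%:R * b * cfun m.+1 n.-1 J x y z w.
Proof.
rewrite /dcfun /cfun -!coefCM -!coefD; apply: (congr1 (fun p : {poly T} => p`_J)).
rewrite -!mul_polyC !rmorphD !rmorphM /= !rmorph_nat.
by case: m => [|m]; case: n => [|n]; rewrite /= ?exprS; ring.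
Qed.

Lemma dcfun_rows (m n J : nat) (x y z w a b c d : T) :
  dcfun m n J x y z w (a * x + b * z) (a * y + b * w) (c * x + d * z) (c * y + d * w) =
  (J%:R * a + (m%:R + n%:R - J%:R) * d) * cfun m n J x y z w
  + (if J is J'.+1 then (m%:R + n%:R - J'%:R) * b * cfun m n J' x y z w else 0)
  + J.+1%:R * c * cfun m n J.+1 x y z w.
Proof.
set P := (x *: 'X + z%:P) ^+ m * (y *: 'X + w%:P) ^+ n.
have PE i : cfun m n i x y z w = P`_i by [].
(* By Euler's identity, E is the derivative of the homogenized P in its second variable, set to 1. A
   row operation then acts as the vector field of a linear substitution in the two variables. *)
pose E := (m%:R + n%:R)%:P * P - P^`() * 'X.
have EE i : E`_i = (m%:R + n%:R - i%:R) * P`_i.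
  rewrite coefB coefCM coefMX mulrBl; congr (_ - _).
  by case: i => [|i] /=; rewrite ?mul0r // coef_deriv mulr_natl.
have -> : dcfun m n J x y z w (a * x + b * z) (a * y + b * w) (c * x + d * z)
    (c * y + d * w) = (a%:P * (P^`() * 'X) + c%:P * P^`() + (b%:P * E) * 'X + d%:P * E)`_J.
  rewrite /dcfun /E; apply: (congr1 (fun p : {poly T} => p`_J)).
  rewrite /P derivM !deriv_exp !derivD !derivZ !derivX !derivC.
  rewrite -!mul_polyC !rmorphD !rmorphM /= !rmorph_nat !mulr1 !addr0.
  clear EE E PE P; case: m => [|m]; case: n => [|n]; rewrite /= ?exprS; ring.
rewrite !coefD !coefCM !coefMX EE !coef_deriv !PE.
case: J => [|J] /=; rewrite ?coefCM ?EE ?coef_deriv ?PE; ring.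

Qed.

End Leibniz.

(** * Differentiable curves of polynomials *)

Section PolynomialDerivative.
Context {R : realType}.
Implicit Types (P Q : R -> {poly R[i]}) (t : R).

(** Coefficientwise, so that no topology on polynomials is involved. *)
Definition pderiv P t (P' : {poly R[i]}) : Prop :=
  forall j, cderiv (fun x => (P x)`_j) t P'`_j.

Lemma pderiv_cst (p : {poly R[i]}) t : pderiv (fun=> p) t 0.
Proof. by move=> j; rewrite coef0; exact: cderiv_cst. Qed.

Lemma cderiv_sum n (f : 'I_n -> R -> R[i]) t (a : 'I_n -> R[i]) :
  (forall i, cderiv (f i) t (a i)) ->
  cderiv (fun x => \sum_(i < n) f i x) t (\sum_(i < n) a i).
Proof.
elim: n f a => [|n IH] f a fa.
  by rewrite big_ord0; under eq_fun do rewrite big_ord0; exact: cderiv_cst.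
rewrite big_ord_recl; under eq_fun do rewrite big_ord_recl.
by apply: cderivD => //; apply: IH => i; exact: fa.
Qed.

Lemma pderivM P Q t (P' Q' : {poly R[i]}) : pderiv P t P' -> pderiv Q t Q' ->
  pderiv (fun x => P x * Q x) t (P' * Q t + P t * Q').
Proof.
move=> dP dQ j; rewrite coefD !coefM -big_split /=.
by under eq_fun do rewrite coefM; apply: cderiv_sum => i; exact: cderivM.
Qed.

Lemma pderivX P t (P' : {poly R[i]}) n : pderiv P t P' ->
  pderiv (fun x => P x ^+ n) t (n%:R * P t ^+ n.-1 * P').
Proof.
move=> dP; elim: n => [|n IH].
  have -> : 0%:R * P t ^+ 0.-1 * P' = 0 :> {poly R[i]} by rewrite !mulr0n !mul0r.
  exact: (pderiv_cst 1).
have -> : n.+1%:R * P t ^+ n.+1.-1 * P' =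
    P' * P t ^+ n + P t * (n%:R * P t ^+ n.-1 * P').
  by case: n {IH} => [|n]; rewrite /= ?exprS -?natr1; ring.
by under eq_fun do rewrite exprS; exact: pderivM.
Qed.

Lemma pderiv_linear (x z : R -> R[i]) t (x' z' : R[i]) :
  cderiv x t x' -> cderiv z t z' ->
  pderiv (fun s => x s *: 'X + (z s)%:P) t (x' *: 'X + z'%:P).
Proof.
move=> dx dz j; rewrite coefD coefZ coefX coefC.
under eq_fun do rewrite coefD coefZ coefX coefC.
apply: cderivD; last by case: eqP => // _; exact: cderiv_cst.
have -> : x' * (j == 1%N)%:R = x' * (j == 1%N)%:R + x t * 0 by rewrite mulr0 addr0.
by apply: cderivM => //; exact: cderiv_cst.
Qed.

Lemma cderiv_cfun (m n J : nat) (x y z w : R -> R[i]) t (x' y' z' w' : R[i]) :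
  cderiv x t x' -> cderiv y t y' -> cderiv z t z' -> cderiv w t w' ->
  cderiv (fun s => cfun m n J (x s) (y s) (z s) (w s)) t
    (dcfun m n J (x t) (y t) (z t) (w t) x' y' z' w').
Proof.
move=> dx dy dz dw.
have -> : dcfun m n J (x t) (y t) (z t) (w t) x' y' z' w' =
    (m%:R * (x t *: 'X + (z t)%:P) ^+ m.-1 * (x' *: 'X + z'%:P)
       * (y t *: 'X + (w t)%:P) ^+ n
     + (x t *: 'X + (z t)%:P) ^+ m
       * (n%:R * (y t *: 'X + (w t)%:P) ^+ n.-1 * (y' *: 'X + w'%:P)))`_J.
  by apply: (congr1 (fun p : {poly R[i]} => p`_J)); ring.
exact: (pderivM (pderivX m (pderiv_linear dx dz)) (pderivX n (pderiv_linear dy dw))).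
Qed.

End PolynomialDerivative.

(** * Ladder relations *)

Section Ladder.
Context {R : realType}.

Lemma natr_mul_sqrt (n : nat) (x y z : R) : 0 <= x -> 0 <= y ->
  n%:R ^+ 2 * x = y * z -> n%:R * Num.sqrt x = Num.sqrt y * Num.sqrt z.
Proof.
move=> x0 y0 e; rewrite -sqrtrM // -e sqrtrM ?sqr_ge0 //.
by rewrite sqrtr_sqr ger0_norm.
Qed.

Let fact_neq0 n : n`!%:R != 0 :> R.
Proof. by rewrite pnatr_eq0 -lt0n fact_gt0. Qed.

Let succ_neq0 n : 1 + n%:R != 0 :> R.
Proof. by rewrite nat1r pnatr_eq0. Qed.

(** A step from m to m + 1 multiplies the square of [wnorm] by (N - m) / (m + 1), so the integer
    factor from differentiation becomes a square root symmetric in the two ends of the step. By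
    [clE] this root is 2 c_l^k for m = l + k. *)
Lemma wnorm_pred_column (N J m : nat) : (m < N)%N ->
  m.+1%:R * wnorm N J m.+1 = Num.sqrt (m.+1 * (N - m))%:R * wnorm N J m :> R.
Proof.
move=> mN; apply: natr_mul_sqrt => //.
have -> : (N - m = (N - m.+1).+1)%N by lia.
rewrite !factS !natrM; field.
by rewrite !fact_neq0 !succ_neq0.
Qed.

Lemma wnorm_succ_column (N J m : nat) : (m < N)%N ->
  (N - m)%:R * wnorm N J m = Num.sqrt (m.+1 * (N - m))%:R * wnorm N J m.+1 :> R.
Proof.
move=> mN; apply: natr_mul_sqrt => //.
have -> : (N - m = (N - m.+1).+1)%N by lia.
rewrite !factS !natrM; field.
by rewrite !fact_neq0 !succ_neq0.
Qed.

Lemma wnorm_pred_row (N J m : nat) : (J < N)%N ->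
  (N - J)%:R * wnorm N J.+1 m = Num.sqrt (J.+1 * (N - J))%:R * wnorm N J m :> R.
Proof.
move=> JN; apply: natr_mul_sqrt => //.
have -> : (N - J = (N - J.+1).+1)%N by lia.
rewrite !factS !natrM; field.
by rewrite !fact_neq0.
Qed.

Lemma wnorm_succ_row (N J m : nat) : (J < N)%N ->
  J.+1%:R * wnorm N J m = Num.sqrt (J.+1 * (N - J))%:R * wnorm N J.+1 m :> R.
Proof.
move=> JN; apply: natr_mul_sqrt => //.
have -> : (N - J = (N - J.+1).+1)%N by lia.
rewrite !factS !natrM; field.
by rewrite !fact_neq0.
Qed.

Lemma clE (l : nat) (k : int) (m : nat) : l%:Z + k = m -> (m <= 2 * l)%N ->
  2 * cl l k = Num.sqrt (m.+1 * (2 * l - m))%:R :> R.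
Proof.
move=> mE ml; rewrite /cl mulVKf ?pnatr_eq0 //; congr Num.sqrt.
have -> : l%:Z - k = (2 * l - m)%N by lia.
have -> : l%:Z + k + 1 = m.+1 by rewrite mE; lia.
by rewrite -PoszM -pmulrn mulnC.
Qed.

(** Here c_l^{-k} = c_l^{k-1}: raising and lowering across the same step share a coefficient, hence
    the shifted index. *)
Lemma clNE (l : nat) (k : int) (m : nat) : l%:Z + k = m.+1 -> (m < 2 * l)%N ->
  2 * cl l (- k) = Num.sqrt (m.+1 * (2 * l - m))%:R :> R.
Proof.
move=> mE ml; rewrite (clE (m := (2 * l - m.+1)%N)); [|lia|lia].
by congr Num.sqrt; rewrite mulnC; congr (_ * _)%:R; lia.
Qed.

Lemma cfun_gt (T : comNzRingType) (a b j : nat) (x y z w : T) : (a + b < j)%N ->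
  cfun a b j x y z w = 0.
Proof.
move=> abj; rewrite cfunE big1 // => i _; have [ia|ai] := leqP i a.
  by rewrite (@bin_small b) ?mul0r ?mulr0 //; lia.
by rewrite bin_small ?mul0r.
Qed.

Variables (l : nat) (k k' : int).
Hypotheses (hk : (`|k| <= l)%N) (hk' : (`|k'| <= l)%N).
Let N := (2 * l)%N.
Let J := `|(l%:Z + k)%R|%N.
Let m := `|(l%:Z + k')%R|%N.
Let A : R := Num.sqrt (2 * l + 1)%:R.
Variable q : @quat R.
Hypothesis nq : qnorm2 q = 1.
Local Notation cfunq a b c := (cfun a b c (u11 q) (u12 q) (u21 q) (u22 q)).

Let mulC_transfer (n : nat) (x y z : R) (c : R[i]) : n%:R * x = y * z ->
  n%:R * (A * x)%:C%C * c = y%:C%C * (A%:C%C * (z%:C%C * c)).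
Proof.
move=> /(congr1 (real_complex R)); rewrite !rmorphM rmorph_nat /= => e.
transitivity (A%:C%C * (n%:R * x%:C%C) * c); first by ring.
by rewrite e; ring.
Qed.

Lemma wignerD_pred_column :
  m%:R * (A * wnorm N J m)%:C%C * cfunq m.-1 (N - m).+1 J =
  (2 * cl l (- k'))%:C%C * wignerD l k (k' - 1) (qrot q).
Proof.
(* At k' = -l both sides vanish: the left through the factor m = 0, the right through the convention
   for [wignerD] out of range. *)
have [k'_min|k'_gt] := leP k' (- l%:Z).
  have -> : m = 0%N by lia.
  rewrite /wignerD (_ : (`|(k' - 1)%R| <= l)%N = false); last by lia.
  by rewrite andbF mulr0 !mul0r.
rewrite wignerD_wfun //; last by lia.
rewrite (_ : `|(l%:Z + (k' - 1))%R|%N = m.-1); last by lia.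
rewrite /wfun -/N -/J -/A (_ : (N - m.-1 = (N - m).+1)%N); last by lia.
apply: mulC_transfer; have [p mE] : exists p, m = p.+1 by exists m.-1; lia.
by rewrite (clNE (m := p)) ?mE ?wnorm_pred_column //; lia.
Qed.

Lemma wignerD_succ_column :
  (N - m)%:R * (A * wnorm N J m)%:C%C * cfunq m.+1 (N - m).-1 J =
  (2 * cl l k')%:C%C * wignerD l k (k' + 1) (qrot q).
Proof.
have [k'_max|k'_lt] := leP l%:Z k'.
  have -> : (N - m = 0)%N by lia.
  rewrite /wignerD (_ : (`|(k' + 1)%R| <= l)%N = false); last by lia.
  by rewrite andbF mulr0 !mul0r.
rewrite wignerD_wfun //; last by lia.
rewrite (_ : `|(l%:Z + (k' + 1))%R|%N = m.+1); last by lia.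
rewrite /wfun -/N -/J -/A (_ : (N - m.+1 = (N - m).-1)%N); last by lia.
by apply: mulC_transfer; rewrite (clE (m := m)) ?wnorm_succ_column //; lia.
Qed.

Lemma wignerD_pred_row :
  (if J is J'.+1 then (N - J')%:R * (A * wnorm N J m)%:C%C * cfunq m (N - m)%N J'
   else 0) = (2 * cl l (- k))%:C%C * wignerD l (k - 1) k' (qrot q).
Proof.
have [k_min|k_gt] := leP k (- l%:Z).
  have -> : J = 0%N by lia.
  by rewrite /wignerD (_ : (`|(k - 1)%R| <= l)%N = false) ?mulr0 //; lia.
rewrite wignerD_wfun //; last by lia.
have [p JE] : exists p, J = p.+1 by exists J.-1; lia.
rewrite (_ : `|(l%:Z + (k - 1))%R|%N = p); last by lia.
rewrite JE /wfun -/N -/m -/A; apply: mulC_transfer.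
by rewrite (clNE (m := p)) ?wnorm_pred_row //; lia.
Qed.

Lemma wignerD_succ_row :
  J.+1%:R * (A * wnorm N J m)%:C%C * cfunq m (N - m)%N J.+1 =
  (2 * cl l k)%:C%C * wignerD l (k + 1) k' (qrot q).
Proof.
(* At k = l the factor J + 1 does not vanish; the coefficient does, because its index exceeds the
   degree 2l. *)
have [k_max|k_lt] := leP l%:Z k.
  rewrite /wignerD (_ : (`|(k + 1)%R| <= l)%N = false); last by lia.
  by rewrite cfun_gt ?mulr0 //; lia.
rewrite wignerD_wfun //; last by lia.
rewrite (_ : `|(l%:Z + (k + 1))%R|%N = J.+1); last by lia.
rewrite /wfun -/N -/m -/A.
by apply: mulC_transfer; rewrite (clE (m := J)) ?wnorm_succ_row //; lia.
Qed.

Let DE : wignerD l k k' (qrot q) = (A * wnorm N J m)%:C%C * cfunq m (N - m)%N J.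
Proof. by rewrite wignerD_wfun // /wfun -/N -/J -/m -/A rmorphM mulrA. Qed.

Local Notation dcfunq q' := (dcfun m (N - m) J (u11 q) (u12 q) (u21 q) (u22 q)
  (u11 q') (u12 q') (u21 q') (u22 q')).

Lemma wignerD_dcfun_columns (p : quat) :
  (A * wnorm N J m)%:C%C * dcfunq (qmul q p) =
  (m%:R * u11 p + (N - m)%:R * u22 p) * wignerD l k k' (qrot q)
  + u21 p * (2 * cl l (- k'))%:C%C * wignerD l k (k' - 1) (qrot q)
  + u12 p * (2 * cl l k')%:C%C * wignerD l k (k' + 1) (qrot q).
Proof.
rewrite -!(mulrA _ (2 * cl _ _)%:C%C) -wignerD_pred_column -wignerD_succ_column DE.
by rewrite u11M u12M u21M u22M dcfun_columns; ring.
Qed.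

Lemma wignerD_dcfun_rows (p : quat) :
  (A * wnorm N J m)%:C%C * dcfunq (qmul p q) =
  (J%:R * u11 p + (N - J)%:R * u22 p) * wignerD l k k' (qrot q)
  + u12 p * (2 * cl l (- k))%:C%C * wignerD l (k - 1) k' (qrot q)
  + u21 p * (2 * cl l k)%:C%C * wignerD l (k + 1) k' (qrot q).
Proof.
rewrite -!(mulrA _ (2 * cl _ _)%:C%C) -wignerD_pred_row -wignerD_succ_row DE.
rewrite u11M u12M u21M u22M dcfun_rows -natrD subnKC; last by lia.
have JN : (J <= N)%N by lia.
rewrite -natrB //; case: (J) JN => [|J'] JN; first by ring.
by rewrite -natrB; [ring|lia].
Qed.

End Ladder.

(** * Derivatives along lifted one-parameter curves *)

Section Gradient.
Context {R : realType}.

Lemma complex_ext (x y : R[i]) : complex.Re x = complex.Re y ->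
  complex.Im x = complex.Im y -> x = y.
Proof. by case: x y => [? ?] [? ?] /= -> ->. Qed.

Lemma cderiv_lift_path (phi : R) (a b : R[i]) :
  cderiv (fun t => (cos (t * phi / 2))%:C%C * a + (sin (t * phi / 2))%:C%C * b) 0
    ((phi / 2)%:C%C * b).
Proof.
have inner : is_derive (0 : R) (1 : R) (fun t => t * phi / 2) (phi / 2).
  have -> : (fun t => t * phi / 2) = (phi / 2) \*: (id : R -> R^o).
    by apply/funext => t /=; rewrite /GRing.scale /=; ring.
  by apply: is_derive_eq; rewrite /GRing.scale /= mulr1.
have cos' : cderiv (fun t => (cos (t * phi / 2))%:C%C) 0 0.
  split; last exact: is_derive_cst.
  have := is_derive1_comp (is_derive_cos _) inner.
  by rewrite /= !mul0r sin0 oppr0 /GRing.scale /= mul0r.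
have sin' : cderiv (fun t => (sin (t * phi / 2))%:C%C) 0 (phi / 2)%:C%C.
  split; last exact: is_derive_cst.
  have := is_derive1_comp (is_derive_sin _) inner.
  by rewrite /= !mul0r cos0 /GRing.scale /= mul1r.
have := cderivD (cderivM cos' (cderiv_cst a 0)) (cderivM sin' (cderiv_cst b 0)).
by rewrite mul0r !mulr0 !addr0 add0r.
Qed.

Lemma expm_lift (phi n1 n2 n3 t : R) (q : quat) :
  n1 ^+ 2 + n2 ^+ 2 + n3 ^+ 2 = 1 ->
  let s := sin (t * phi / 2) in
  expm (t *: (phi *: so3_mx n1 n2 n3)) *m qrot q =
  qrot (qmul (Quat (cos (t * phi / 2)) (s * n1) (s * n2) (s * n3)) q).
Proof. by move=> n_unit s; rewrite scalerA expm_qrot // -qrotM. Qed.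

(** The lift stays on the unit sphere for every t, so [wignerD_wfun] applies along the whole curve.
    The halves in q' come from the half angle of the double cover. *)
Lemma cderiv_wignerD (l : nat) (k k' : int) (q : quat) (S : 'M[R]_3) :
  (`|k| <= l)%N -> (`|k'| <= l)%N -> qnorm2 q = 1 -> so3 S ->
  let N := (2 * l)%N in
  let J := `|(l%:Z + k)%R|%N in let m := `|(l%:Z + k')%R|%N in
  exists s1 s2 s3, S = so3_mx s1 s2 s3 /\
  let q' := qmul (Quat 0 (s1 / 2) (s2 / 2) (s3 / 2)) q in
  cderiv (fun t => wignerD l k k' (expm (t *: S) *m qrot q)) 0
    ((Num.sqrt (2 * l + 1)%:R * wnorm N J m)%:C%C *
     dcfun m (N - m) J (u11 q) (u12 q) (u21 q) (u22 q)
       (u11 q') (u12 q') (u21 q') (u22 q')).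
Proof.
move=> hk hk' nq /so3P[phi [n1 [n2 [n3 [n_unit ->]]]]] N J m.
exists (phi * n1), (phi * n2), (phi * n3); split.
  by rewrite /so3_mx mx3_scale !mulr0 !mulrN.
move=> q'.
pose p t := Quat (cos (t * phi / 2)) (sin (t * phi / 2) * n1)
  (sin (t * phi / 2) * n2) (sin (t * phi / 2) * n3).
pose r := qmul (Quat 0 n1 n2 n3) q.
have np t : qnorm2 (qmul (p t) q) = 1.
  have n1E : n1 ^+ 2 = 1 - n2 ^+ 2 - n3 ^+ 2 by lra.
  have cosE : cos (t * phi / 2) ^+ 2 = 1 - sin (t * phi / 2) ^+ 2.
    by have := cos2Dsin2 (t * phi / 2); lra.
  by rewrite qnorm2M nq mulr1 /qnorm2 /=; ring: cosE n1E.
have u11E t : u11 (qmul (p t) q) =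
    (cos (t * phi / 2))%:C%C * u11 q + (sin (t * phi / 2))%:C%C * u11 r.
  by apply: complex_ext; rewrite /=; ring.
have u12E t : u12 (qmul (p t) q) =
    (cos (t * phi / 2))%:C%C * u12 q + (sin (t * phi / 2))%:C%C * u12 r.
  by apply: complex_ext; rewrite /=; ring.
have u21E t : u21 (qmul (p t) q) =
    (cos (t * phi / 2))%:C%C * u21 q + (sin (t * phi / 2))%:C%C * u21 r.
  by apply: complex_ext; rewrite /=; ring.
have u22E t : u22 (qmul (p t) q) =
    (cos (t * phi / 2))%:C%C * u22 q + (sin (t * phi / 2))%:C%C * u22 r.
  by apply: complex_ext; rewrite /=; ring.
have DE t : wignerD l k k' (expm (t *: (phi *: so3_mx n1 n2 n3)) *m qrot q) =
    (Num.sqrt (2 * l + 1)%:R * wnorm N J m)%:C%C * cfun m (N - m) J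
      ((cos (t * phi / 2))%:C%C * u11 q + (sin (t * phi / 2))%:C%C * u11 r)
      ((cos (t * phi / 2))%:C%C * u12 q + (sin (t * phi / 2))%:C%C * u12 r)
      ((cos (t * phi / 2))%:C%C * u21 q + (sin (t * phi / 2))%:C%C * u21 r)
      ((cos (t * phi / 2))%:C%C * u22 q + (sin (t * phi / 2))%:C%C * u22 r).
  rewrite expm_lift // -[Quat _ _ _ _]/(p t) wignerD_wfun // /wfun u11E u12E u21E u22E.
  by rewrite -/N -/J -/m mulrA -rmorphM.
have -> : (fun t => wignerD l k k' (expm (t *: (phi *: so3_mx n1 n2 n3)) *m qrot q)) =
  _ := funext DE.
have d11 := cderiv_lift_path phi (u11 q) (u11 r).
have d12 := cderiv_lift_path phi (u12 q) (u12 r).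
have d21 := cderiv_lift_path phi (u21 q) (u21 r).
have d22 := cderiv_lift_path phi (u22 q) (u22 r).
have := cderivM (cderiv_cst (Num.sqrt (2 * l + 1)%:R * wnorm N J m)%:C%C 0)
  (cderiv_cfun m (N - m) J d11 d12 d21 d22).
rewrite mul0r add0r.
have at0 (a b : R[i]) : (cos (0 * phi / 2))%:C%C * a + (sin (0 * phi / 2))%:C%C * b = a.
  by rewrite !mul0r cos0 sin0 mul0r addr0 mul1r.
rewrite !at0.
have -> : (phi / 2)%:C%C * u11 r = u11 q' by apply: complex_ext; rewrite /=; field.
have -> : (phi / 2)%:C%C * u12 r = u12 q' by apply: complex_ext; rewrite /=; field.
have -> : (phi / 2)%:C%C * u21 r = u21 q' by apply: complex_ext; rewrite /=; field.
have -> : (phi / 2)%:C%C * u22 r = u22 q' by apply: complex_ext; rewrite /=; field.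
exact.
Qed.

End Gradient.

(** * Gradients in the three frames *)

Section Frames.
Context {R : realType}.
Implicit Types (M S T : 'M[R]_3).

Lemma row3_mul (K : comNzRingType) (x y z a b c d e f g h i : K) :
  row3 [:: x; y; z] *m mx3 [:: [:: a; b; c]; [:: d; e; f]; [:: g; h; i]] =
  row3 [:: x * a + y * d + z * g; x * b + y * e + z * h; x * c + y * f + z * i].
Proof.
apply/matrixP => -[[|//] ?] [[|[|[|//]]] ?];
  by rewrite !mxE !big_ord_recl big_ord0 !mxE /= addr0 !addrA.
Qed.

Lemma frame_combE (v1 v2 v3 : R[i]) (F1 F2 F3 : 'M[R]_3) :
  frame_comb (row3 [:: v1; v2; v3]) [:: F1; F2; F3] =
  v1 *: map_mx (real_complex R) F1 + v2 *: map_mx (real_complex R) F2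
  + v3 *: map_mx (real_complex R) F3.
Proof. by rewrite /frame_comb !big_ord_recl big_ord0 !mxE /= addr0 !addrA. Qed.

Lemma metricDl M T S : metric (M + T) S = metric M S + metric T S.
Proof. by rewrite /metric raddfD /= mulmxDl raddfD /= mulrDr. Qed.

Lemma metricZl (x : R) M S : metric (x *: M) S = x * metric M S.
Proof. by rewrite /metric linearZ /= -scalemxAl mxtraceZ mulrCA. Qed.

Lemma tangentD M S T : tangent M S -> tangent M T -> tangent M (S + T).
Proof.
move=> [A hA <-] [B hB <-]; exists (A + B); last by rewrite mulmxDl.
by rewrite /so3 /= raddfD /= hA hB opprD.
Qed.

Lemma tangentZ M (x : R) S : tangent M S -> tangent M (x *: S).
Proof.
move=> [A hA <-]; exists (x *: A); last by rewrite scalemxAl.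
by rewrite /so3 /= linearZ /= hA scalerN.
Qed.

(** The frame is real, so real and imaginary parts act on the coefficients alone, and the two real
    gradient conditions merge into one complex derivative. *)
Lemma is_cgradient_frame (f : 'M[R]_3 -> R[i]) M (v1 v2 v3 : R[i]) F1 F2 F3 :
  tangent M F1 -> tangent M F2 -> tangent M F3 ->
  (forall S, so3 S -> cderiv (fun t => f (expm (t *: S) *m M)) 0
    (v1 * (metric F1 (S *m M))%:C%C + v2 * (metric F2 (S *m M))%:C%C
     + v3 * (metric F3 (S *m M))%:C%C)) ->
  is_cgradient f M (frame_comb (row3 [:: v1; v2; v3]) [:: F1; F2; F3]).
Proof.
move=> t1 t2 t3 df; rewrite frame_combE.
have ReE : map_mx (@complex.Re R) (v1 *: map_mx (real_complex R) F1 +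
    v2 *: map_mx (real_complex R) F2 + v3 *: map_mx (real_complex R) F3) =
    complex.Re v1 *: F1 + complex.Re v2 *: F2 + complex.Re v3 *: F3.
  apply/matrixP => i j; rewrite !mxE !raddfD /=.
  by case: v1 v2 v3 {df} => [? ?] [? ?] [? ?] /=; ring.
have ImE : map_mx (@complex.Im R) (v1 *: map_mx (real_complex R) F1 +
    v2 *: map_mx (real_complex R) F2 + v3 *: map_mx (real_complex R) F3) =
    complex.Im v1 *: F1 + complex.Im v2 *: F2 + complex.Im v3 *: F3.
  apply/matrixP => i j; rewrite !mxE !raddfD /=.
  by case: v1 v2 v3 {df ReE} => [? ?] [? ?] [? ?] /=; ring.
split; split=> [|S hS]; rewrite ?ReE ?ImE; try by do ?apply: tangentD;
  exact: tangentZ.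
- rewrite !metricDl !metricZl; case: (df S hS) => dRe _; apply: is_derive_eq.
  by case: v1 v2 v3 {df ReE ImE dRe} => [? ?] [? ?] [? ?] /=; ring.
- rewrite !metricDl !metricZl; case: (df S hS) => _ dIm; apply: is_derive_eq.
  by case: v1 v2 v3 {df ReE ImE dIm} => [? ?] [? ?] [? ?] /=; ring.
Qed.

Lemma e_xE : e_x = so3_mx 1 0 0 :> 'M[R]_3.
Proof. by rewrite /so3_mx !oppr0. Qed.
Lemma e_yE : e_y = so3_mx 0 1 0 :> 'M[R]_3.
Proof. by rewrite /so3_mx !oppr0. Qed.
Lemma e_zE : e_z = so3_mx 0 0 1 :> 'M[R]_3.
Proof. by rewrite /so3_mx !oppr0. Qed.

Lemma so3_mx_so3 (a b c : R) : so3 (so3_mx a b c).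
Proof. by rewrite /so3 /= /so3_mx mx3_tr mx3_opp !opprK !oppr0. Qed.

Lemma tangent_right M a b c : tangent M (so3_mx a b c *m M).
Proof. by exists (so3_mx a b c) => //; exact: so3_mx_so3. Qed.

Lemma so3_mxE (a b c : R) : so3_mx a b c =
  a *: so3_mx 1 0 0 + b *: so3_mx 0 1 0 + c *: so3_mx 0 0 1.
Proof.
rewrite /so3_mx !mx3_scale !mx3_add.
by congr (mx3 [:: [:: _; _; _]; [:: _; _; _]; [:: _; _; _]]); ring.
Qed.

Lemma tangent_left M a b c : SO3 M -> tangent M (M *m so3_mx a b c).
Proof.
move=> [/mulmx1C M1 _]; exists (M *m so3_mx a b c *m M^T).
  by rewrite /so3 /= !trmx_mul trmxK (so3_mx_so3 a b c) mulNmx mulmxN mulmxA.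
by rewrite -mulmxA M1 mulmx1.
Qed.

Lemma metric_right M a b c x y z : SO3 M ->
  metric (so3_mx a b c *m M) (so3_mx x y z *m M) = a * x + b * y + c * z.
Proof.
move=> [M1 _]; rewrite /metric trmx_mul -mulmxA mxtrace_mulC -!mulmxA M1 mulmx1.
by rewrite /so3_mx mx3_tr mx3_mul mx3_trace; field.
Qed.

Lemma metric_left M a b c x y z : SO3 M ->
  metric (M *m so3_mx a b c) (M *m so3_mx x y z) = a * x + b * y + c * z.
Proof.
move=> [/mulmx1C M1 _]; rewrite /metric trmx_mul -mulmxA (mulmxA M^T) M1 mul1mx.
by rewrite /so3_mx mx3_tr mx3_mul mx3_trace; field.
Qed.

(* Exchanges the two sides, so that left perturbations of [q] act on columns. *)
Lemma qmul_imaginary (q : quat) (s1 s2 s3 : R) : qnorm2 q = 1 ->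
  exists x y z, so3_mx s1 s2 s3 *m qrot q = qrot q *m so3_mx x y z /\
    qmul (Quat 0 (s1 / 2) (s2 / 2) (s3 / 2)) q =
    qmul q (Quat 0 (x / 2) (y / 2) (z / 2)).
Proof.
case: q => [a b c d] nq; have := nq; rewrite /qnorm2 /= => a2.
have {}a2 : a ^+ 2 = 1 - b ^+ 2 - c ^+ 2 - d ^+ 2 by lra.
(* The witness is the transpose of [qrot q] applied to (s1, s2, s3). *)
exists ((a ^+ 2 + b ^+ 2 - c ^+ 2 - d ^+ 2) * s1 + 2 * (b * c + a * d) * s2
    + 2 * (b * d - a * c) * s3),
  (2 * (b * c - a * d) * s1 + (a ^+ 2 - b ^+ 2 + c ^+ 2 - d ^+ 2) * s2
    + 2 * (c * d + a * b) * s3),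
  (2 * (b * d + a * c) * s1 + 2 * (c * d - a * b) * s2
    + (a ^+ 2 - b ^+ 2 - c ^+ 2 + d ^+ 2) * s3).
split.
  rewrite /so3_mx /qrot !mx3_mul.
  by congr (mx3 [:: [:: _; _; _]; [:: _; _; _]; [:: _; _; _]]); ring: a2.
by rewrite /qmul /=; congr Quat; field: a2.
Qed.

Lemma SO3_qrot M : SO3 M -> exists2 q, qnorm2 q = 1 & M = qrot q.
Proof.
move=> /euler_angles_exist[[[alpha beta] gamma] [_ ->]].
by exists (qeuler alpha beta gamma); rewrite ?eulerE // qnorm2_euler.
Qed.

End Frames.

(** * Directional derivatives in the invariant frames *)

Section WignerGradient.
Context {R : realType}.
Variables (l : nat) (k k' : int).
Hypotheses (hk : (`|k| <= l)%N) (hk' : (`|k'| <= l)%N).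
Local Notation D := (@wignerD R l).
Local Notation i := ('i%C : R[i]).
Local Notation c j := ((@cl R l j)%:C%C : R[i]).

(** The products with 0 are kept because they are what [row3_mul] produces from the coefficient
    matrix. *)
Lemma cderiv_wignerD_right (M : 'M[R]_3) S : SO3 M -> so3 S ->
  cderiv (fun t => D k k' (expm (t *: S) *m M)) 0
    ((D (k - 1) k' M * (- i * c (- k)) + D k k' M * 0 + D (k + 1) k' M * (- i * c k))
       * (metric (e_x *m M) (S *m M))%:C%C
     + (D (k - 1) k' M * (- c (- k)) + D k k' M * 0 + D (k + 1) k' M * c k)
       * (metric (e_y *m M) (S *m M))%:C%C
     + (D (k - 1) k' M * 0 + D k k' M * (- i * k%:~R) + D (k + 1) k' M * 0)
       * (metric (e_z *m M) (S *m M))%:C%C).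
Proof.
move=> MSO; have [q nq ME] := SO3_qrot MSO.
move=> /(cderiv_wignerD hk hk' nq)[s1 [s2 [s3 [-> H]]]].
rewrite e_xE e_yE e_zE !metric_right // !(mul0r, mul1r, add0r, addr0).
move: H => /=; rewrite -ME wignerD_dcfun_rows // -ME.
set J := `|_|%N.
(* The diagonal part (l + k) u11 + (l - k) u22 will collapse to -i k s3. *)
have JE : J%:R = l%:R + k%:~R :> R[i].
  by rewrite !pmulrn -intrD; congr _%:~R; lia.
have NJE : (2 * l - J)%:R = l%:R - k%:~R :> R[i].
  by rewrite !pmulrn -intrB; congr _%:~R; lia.
rewrite JE NJE.
have -> : u11 (Quat 0 (s1 / 2) (s2 / 2) (s3 / 2)) = - i * (s3 / 2)%:C%C.
  by apply: complex_ext; rewrite /=; ring.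
have -> : u12 (Quat 0 (s1 / 2) (s2 / 2) (s3 / 2)) =
    - (s2 / 2)%:C%C - i * (s1 / 2)%:C%C.
  by apply: complex_ext; rewrite /=; ring.
have -> : u21 (Quat 0 (s1 / 2) (s2 / 2) (s3 / 2)) =
    (s2 / 2)%:C%C - i * (s1 / 2)%:C%C.
  by apply: complex_ext; rewrite /=; ring.
have -> : u22 (Quat 0 (s1 / 2) (s2 / 2) (s3 / 2)) = i * (s3 / 2)%:C%C.
  by apply: complex_ext; rewrite /=; ring.
congr (cderiv _ 0 _); field; rewrite ?pnatr_eq0 //.
Qed.

Lemma cderiv_wignerD_left (M : 'M[R]_3) S : SO3 M -> so3 S ->
  cderiv (fun t => D k k' (expm (t *: S) *m M)) 0
    ((D k (k' - 1) M * (- i * c (- k')) + D k k' M * 0 + D k (k' + 1) M * (- i * c k'))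
       * (metric (M *m e_x) (S *m M))%:C%C
     + (D k (k' - 1) M * c (- k') + D k k' M * 0 + D k (k' + 1) M * (- c k'))
       * (metric (M *m e_y) (S *m M))%:C%C
     + (D k (k' - 1) M * 0 + D k k' M * (- i * k'%:~R) + D k (k' + 1) M * 0)
       * (metric (M *m e_z) (S *m M))%:C%C).
Proof.
move=> MSO; have [q nq ME] := SO3_qrot MSO.
move=> /(cderiv_wignerD hk hk' nq)[s1 [s2 [s3 [-> H]]]].
have [x [y [z [conjE qE]]]] := qmul_imaginary s1 s2 s3 nq.
rewrite [in metric (M *m _)]ME.
move: H => /=; rewrite ME conjE qE wignerD_dcfun_columns // -ME.
rewrite e_xE e_yE e_zE !metric_left // !(mul0r, mul1r, add0r, addr0).
set m := `|(l%:Z + k')%R|%N.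
have mE : m%:R = l%:R + k'%:~R :> R[i].
  by rewrite !pmulrn -intrD; congr _%:~R; lia.
have NmE : (2 * l - m)%:R = l%:R - k'%:~R :> R[i].
  by rewrite !pmulrn -intrB; congr _%:~R; lia.
rewrite mE NmE.
have -> : u11 (Quat 0 (x / 2) (y / 2) (z / 2)) = - i * (z / 2)%:C%C.
  by apply: complex_ext; rewrite /=; ring.
have -> : u12 (Quat 0 (x / 2) (y / 2) (z / 2)) =
    - (y / 2)%:C%C - i * (x / 2)%:C%C.
  by apply: complex_ext; rewrite /=; ring.
have -> : u21 (Quat 0 (x / 2) (y / 2) (z / 2)) =
    (y / 2)%:C%C - i * (x / 2)%:C%C.
  by apply: complex_ext; rewrite /=; ring.
have -> : u22 (Quat 0 (x / 2) (y / 2) (z / 2)) = i * (z / 2)%:C%C.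
  by apply: complex_ext; rewrite /=; ring.
congr (cderiv _ 0 _); field; rewrite ?pnatr_eq0 //.
Qed.

End WignerGradient.

Lemma cderiv_unique (R : realType) (f : R -> R[i]) t a b :
  cderiv f t a -> cderiv f t b -> a = b.
Proof.
move=> [[_ aRe] [_ aIm]] [[_ bRe] [_ bIm]].
by apply: complex_ext; rewrite -?aRe -?aIm.
Qed.

(** * The Euler angle frame in terms of the right-invariant frame *)

Section EulerFrame.
Context {R : realType}.

Lemma derive1_trig_mx (X Y Z : 'M[R]_3) (t : R) :
  derive1 (fun a => cos a *: X + sin a *: Y + Z) t = - sin t *: X + cos t *: Y.
Proof.
have entry i j : is_derive t 1 (fun a => (cos a *: X + sin a *: Y + Z) i j)
    ((- sin t *: X + cos t *: Y) i j).
  under eq_fun do rewrite !mxE.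
  by apply: is_derive_eq; rewrite !mxE /GRing.scale /=; ring.
rewrite derive1E derive_mx; last by apply/derivable_mxP => i j; case: (entry i j).
by apply/matrixP => i j; rewrite mxE; case: (entry i j).
Qed.

Lemma rot_z_trig (t : R) : rot_z t =
  cos t *: mx3 [:: [:: 1; 0; 0]; [:: 0; 1; 0]; [:: 0; 0; 0]] + sin t *: e_z
  + mx3 [:: [:: 0; 0; 0]; [:: 0; 0; 0]; [:: 0; 0; 1]].
Proof.
rewrite rot_z_mx3 /e_z !mx3_scale !mx3_add.
by congr (mx3 [:: [:: _; _; _]; [:: _; _; _]; [:: _; _; _]]); ring.
Qed.

Lemma rot_y_trig (t : R) : rot_y t =
  cos t *: mx3 [:: [:: 1; 0; 0]; [:: 0; 0; 0]; [:: 0; 0; 1]] + sin t *: e_y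
  + mx3 [:: [:: 0; 0; 0]; [:: 0; 1; 0]; [:: 0; 0; 0]].
Proof.
rewrite rot_y_mx3 /e_y !mx3_scale !mx3_add.
by congr (mx3 [:: [:: _; _; _]; [:: _; _; _]; [:: _; _; _]]); ring.
Qed.

Lemma derive1_rot_z (L N : 'M[R]_3) (t : R) :
  derive1 (fun a => L *m rot_z a *m N) t = L *m (e_z *m rot_z t) *m N.
Proof.
have -> : e_z *m rot_z t = - sin t *: mx3 [:: [:: 1; 0; 0]; [:: 0; 1; 0]; [:: 0; 0; 0]]
    + cos t *: e_z.
  rewrite rot_z_mx3 /e_z !mx3_scale mx3_mul mx3_add.
  by congr (mx3 [:: [:: _; _; _]; [:: _; _; _]; [:: _; _; _]]); ring.
under eq_fun do rewrite rot_z_trig !mulmxDr !mulmxDl -!scalemxAr -!scalemxAl.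
by rewrite derive1_trig_mx mulmxDr mulmxDl -!scalemxAr -!scalemxAl.
Qed.

Lemma derive1_rot_y (L N : 'M[R]_3) (t : R) :
  derive1 (fun a => L *m rot_y a *m N) t = L *m (e_y *m rot_y t) *m N.
Proof.
have -> : e_y *m rot_y t = - sin t *: mx3 [:: [:: 1; 0; 0]; [:: 0; 0; 0]; [:: 0; 0; 1]]
    + cos t *: e_y.
  rewrite rot_y_mx3 /e_y !mx3_scale mx3_mul mx3_add.
  by congr (mx3 [:: [:: _; _; _]; [:: _; _; _]; [:: _; _; _]]); ring.
under eq_fun do rewrite rot_y_trig !mulmxDr !mulmxDl -!scalemxAr -!scalemxAl.
by rewrite derive1_trig_mx mulmxDr mulmxDl -!scalemxAr -!scalemxAl.
Qed.

(** Conjugation by a rotation turns [e_z] into the skew matrix of the rotated z-axis, the third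
    column. Both sides are d/dgamma, which is what makes the left and right formulas comparable. *)
Lemma euler_e_z (alpha beta gamma : R) :
  euler alpha beta gamma *m e_z =
  so3_mx (sin beta * cos alpha) (sin beta * sin alpha) (cos beta)
  *m euler alpha beta gamma.
Proof.
have -> : euler alpha beta gamma *m e_z =
    (rot_z alpha *m (rot_y beta *m e_z)) *m rot_z gamma.
  rewrite /euler -!mulmxA; do 2!congr (_ *m _).
  rewrite rot_z_mx3 /e_z !mx3_mul.
  by congr (mx3 [:: [:: _; _; _]; [:: _; _; _]; [:: _; _; _]]); ring.
rewrite /euler !mulmxA; congr (_ *m _).
have ca2 : cos alpha ^+ 2 = 1 - sin alpha ^+ 2 by have := cos2Dsin2 alpha; lra.
have cb2 : cos beta ^+ 2 = 1 - sin beta ^+ 2 by have := cos2Dsin2 beta; lra.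
rewrite rot_z_mx3 rot_y_mx3 /e_z /so3_mx !mx3_mul.
by congr (mx3 [:: [:: _; _; _]; [:: _; _; _]; [:: _; _; _]]); ring: ca2 cb2.
Qed.

(** Each partial derivative inserts a generator next to its own factor; conjugating it past the
    factors on its left gives the axis displayed. *)
Lemma euler_frameE (alpha beta gamma : R) :
  let M := euler alpha beta gamma in
  euler_frame alpha beta gamma =
  [:: e_z *m M; so3_mx (- sin alpha) (cos alpha) 0 *m M;
      so3_mx (sin beta * cos alpha) (sin beta * sin alpha) (cos beta) *m M].
Proof.
move=> M; rewrite /euler_frame; congr [:: _; _; _].
- rewrite (_ : (fun a => euler a beta gamma) =
    fun a => 1%:M *m rot_z a *m (rot_y beta *m rot_z gamma)); last first.
    by apply/funext => a; rewrite mul1mx mulmxA.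
  rewrite derive1_rot_z [X in X *m _](mul1mx (e_z *m rot_z alpha)) /M /euler.
  have assoc (A B C N : 'M[R]_3) : A *m B *m (C *m N) = A *m (B *m C *m N).
    by rewrite !mulmxA.
  exact: assoc.
- rewrite derive1_rot_y /M /euler !mulmxA; do 2!congr (_ *m _).
  have ca2 : cos alpha ^+ 2 = 1 - sin alpha ^+ 2 by have := cos2Dsin2 alpha; lra.
  rewrite rot_z_mx3 /e_y /so3_mx !mx3_mul.
  by congr (mx3 [:: [:: _; _; _]; [:: _; _; _]; [:: _; _; _]]); ring: ca2.
- rewrite (_ : (fun a => euler alpha beta a) =
    fun a => rot_z alpha *m rot_y beta *m rot_z a *m 1%:M); last first.
    by apply/funext => a; rewrite mulmx1.
  rewrite derive1_rot_z [LHS]mulmx1 -[RHS]euler_e_z /M /euler -[RHS]mulmxA.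
  congr (_ *m _).
  rewrite rot_z_mx3 /e_z !mx3_mul.
  by congr (mx3 [:: [:: _; _; _]; [:: _; _; _]; [:: _; _; _]]); ring.
Qed.

End EulerFrame.

(* The Euler angle components of the gradient agree with the right-invariant
   ones thanks to the three-term recurrence [rec], which says that the left- and
   right-invariant formulas give the same derivative in the direction of
   d/dgamma. *)
Lemma euler_coefficients (F : fieldType) (i ca sa cb sb A B D k k' : F) :
  i ^+ 2 = -1 -> ca ^+ 2 = 1 - sa ^+ 2 -> cb ^+ 2 = 1 - sb ^+ 2 -> sb != 0 ->
  sb * (A * (ca - i * sa) + B * (ca + i * sa)) = (k' - k * cb) * D ->
  let v1 := D * ((i * k' * cb - i * k) / sb ^+ 2) in
  let v2 := - (A * (ca - i * sa)) + B * (ca + i * sa) in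
  let v3 := D * ((i * k * cb - i * k') / sb ^+ 2) in
  [/\ v2 * - sa + v3 * (sb * ca) = - i * A - i * B,
      v2 * ca + v3 * (sb * sa) = - A + B
    & v1 + v3 * cb = - i * k * D].
Proof.
move=> i2 ca2 cb2 sb0 rec v1 v2 v3.
have v3sb : v3 * sb = - i * (A * (ca - i * sa) + B * (ca + i * sa)).
  apply: (mulfI sb0); rewrite mulrCA [in RHS]mulrCA rec /v3; field.
  exact: sb0.
split; rewrite ?[v3 * (sb * _)]mulrA ?v3sb /v2; [ring: i2 ca2|ring: i2 ca2|].
by rewrite /v1 /v3; field: cb2.
Qed.

Theorem theorem4p3 (R : realType) (l : nat) (k k' : int)
    (hk : (`|k| <= l)%N) (hk' : (`|k'| <= l)%N) :
  let i : R[i] := ('i)%C in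
  let D := @wignerD R l in
  let c (j : int) : R[i] := (@cl R l j)%:C%C in
  [/\ forall alpha beta gamma : R, 0 < beta < pi ->
        let M := euler alpha beta gamma in
        let cosb : R[i] := (cos beta)%:C%C in
        let sinb : R[i] := (sin beta)%:C%C in
        is_cgradient (D k k') M
          (frame_comb
             (row3 [:: D (k - 1) k' M; D k k' M; D (k + 1) k' M] *m
              mx3 [:: [:: 0; - c (- k) * expi (- alpha); 0];
                      [:: (i * k'%:~R * cosb - i * k%:~R) / sinb ^+ 2; 0;
                          (i * k%:~R * cosb - i * k'%:~R) / sinb ^+ 2];
                      [:: 0; c k * expi alpha; 0]])
             (euler_frame alpha beta gamma)),
      forall M : 'M[R]_3, SO3 M ->
        is_cgradient (D k k') M
          (frame_comb
             (row3 [:: D k (k' - 1) M; D k k' M; D k (k' + 1) M] *m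
              mx3 [:: [:: - i * c (- k'); c (- k'); 0];
                      [:: 0; 0; - i * k'%:~R];
                      [:: - i * c k'; - c k'; 0]])
             (left_frame M))
    & forall M : 'M[R]_3, SO3 M ->
        is_cgradient (D k k') M
          (frame_comb
             (row3 [:: D (k - 1) k' M; D k k' M; D (k + 1) k' M] *m
              mx3 [:: [:: - i * c (- k); - c (- k); 0];
                      [:: 0; 0; - i * k%:~R];
                      [:: - i * c k; c k; 0]])
             (right_frame M))].
Proof.
move=> i D c.
have left_grad M : SO3 M -> is_cgradient (D k k') M
    (frame_comb
       (row3 [:: D k (k' - 1) M; D k k' M; D k (k' + 1) M] *m
        mx3 [:: [:: - i * c (- k'); c (- k'); 0];
                [:: 0; 0; - i * k'%:~R];
                [:: - i * c k'; - c k'; 0]])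
       (left_frame M)).
  move=> MSO; rewrite row3_mul; apply: is_cgradient_frame;
    rewrite ?e_xE ?e_yE ?e_zE; do ?exact: tangent_left.
  by move=> S hS; rewrite -e_xE -e_yE -e_zE; exact: cderiv_wignerD_left.
have right_grad M : SO3 M -> is_cgradient (D k k') M
    (frame_comb
       (row3 [:: D (k - 1) k' M; D k k' M; D (k + 1) k' M] *m
        mx3 [:: [:: - i * c (- k); - c (- k); 0];
                [:: 0; 0; - i * k%:~R];
                [:: - i * c k; c k; 0]])
       (right_frame M)).
  move=> MSO; rewrite row3_mul; apply: is_cgradient_frame;
    rewrite ?e_xE ?e_yE ?e_zE; do ?exact: tangent_right.
  by move=> S hS; rewrite -e_xE -e_yE -e_zE; exact: cderiv_wignerD_right.
split => // alpha beta gamma /andP[beta0 betapi] M cosb sinb.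
have MSO : SO3 M by rewrite /M eulerE; apply: qrot_SO3; exact: qnorm2_euler.
have sinb0 : sinb != 0.
  by rewrite fmorph_eq0 gt_eqF // sin_gt0_pi // beta0.
pose A := D (k - 1) k' M * c (- k); pose B := D (k + 1) k' M * c k.
pose ca : R[i] := (cos alpha)%:C%C; pose sa : R[i] := (sin alpha)%:C%C.
have i2 : i ^+ 2 = -1 by exact: sqr_i.
have ca2 : ca ^+ 2 = 1 - sa ^+ 2.
  have /(congr1 (real_complex R)) := cos2Dsin2 alpha.
  by rewrite rmorphD !rmorphXn rmorph1 => <-; rewrite addrK.
have cb2 : cosb ^+ 2 = 1 - sinb ^+ 2.
  have /(congr1 (real_complex R)) := cos2Dsin2 beta.
  by rewrite rmorphD !rmorphXn rmorph1 => <-; rewrite addrK.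
have rec : sinb * (A * (ca - i * sa) + B * (ca + i * sa)) =
    (k'%:~R - k%:~R * cosb) * D k k' M.
  (* For this S, [S *m M] is [M *m e_z]: the left formula contributes only its z-term, the right one
     all three. The common factor -i is then cancelled. *)
  have hS := so3_mx_so3 (sin beta * cos alpha) (sin beta * sin alpha) (cos beta).
  have := cderiv_unique (cderiv_wignerD_right hk hk' MSO hS)
    (cderiv_wignerD_left hk hk' MSO hS).
  rewrite e_xE e_yE e_zE !metric_right // -euler_e_z e_zE !metric_left //.
  rewrite !(mul0r, mul1r, mulr0, mulr1, add0r, addr0).
  rewrite !(rmorphM (real_complex R) (sin beta)) /=.
  rewrite -/ca -/sa -/sinb -/cosb -/i -/D -!/(c _) => rec.
  apply: (mulfI (_ : - i != 0)).
    by rewrite oppr_eq0 -sqrf_eq0 i2 oppr_eq0 oner_eq0.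
  transitivity (D k k' M * (- i * k'%:~R) + i * k%:~R * cosb * D k k' M).
    by rewrite -rec /A /B; ring: i2.
  by ring.
have [e1 e2 e3] := euler_coefficients i2 ca2 cb2 sinb0 rec.
have expiE : expi alpha = ca + i * sa by apply: complex_ext; rewrite /=; ring.
have expiNE : expi (- alpha) = ca - i * sa.
  by apply: complex_ext; rewrite /= ?cosN ?sinN; ring.
(* The gradient is already known in the right-invariant frame; it suffices that the Euler angle
   combination is the same matrix. *)
have := right_grad M MSO.
set G := frame_comb _ _; set G' := frame_comb _ _.
suff -> : G = G' by [].
rewrite /G /G' euler_frameE !row3_mul /right_frame !frame_combE.
rewrite e_xE e_yE e_zE expiE expiNE.
rewrite (so3_mxE (- sin alpha)) (so3_mxE (sin beta * _)).
rewrite !mulmxDl -!scalemxAl !map_mxD !map_mxZ.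
set X := map_mx _ _; set Y := map_mx _ _; set Z := map_mx _ _.
rewrite !rmorphM rmorphN rmorph0.
rewrite /= -/ca -/sa -/cosb -/sinb.
transitivity ((- i * A - i * B) *: X + (- A + B) *: Y
    + (- i * k%:~R * D k k' M) *: Z).
  by congr (_ *: X + _ *: Y + _ *: Z); rewrite /A /B; ring.
rewrite -e1 -e2 -e3 /A /B; move: (X) (Y) (Z) => X' Y' Z'.
by apply/matrixP => a b; rewrite !mxE; ring.
Qed.
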